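(* Let $L_1$ and $L_2$ be locally compact Hausdorff topological spaces, and let $C_0(L_1)$, $C_0(L_2)$ be the corresponding complex Banach spaces of complex-valued continuous functions vanishing at infinity. Then the pair $(C_0(L_1), C_0(L_2))$ has the Bishop-Phelps-Bollobás property for bilinear forms. Moreover, the constant can be chosen independently of $L_1$ and $L_2$: for every $0<\varepsilon<1$ there exists $\eta(\varepsilon)>0$ such that for all locally compact Hausdorff topological spaces $L_1$, $L_2$, every $B\in \mathcal{B}(C_0(L_1)\times C_0(L_2))$ with $\|B\|=1$ and every $(x_0,y_0)\in S_{C_0(L_1)}\times S_{C_0(L_2)}$ with $|B(x_0,y_0)|>1-\eta(\varepsilon)$, there exist $(x_1,y_1)\in S_{C_0(L_1)}\times S_{C_0(L_2)}$ and $S\in\mathcal{B}(C_0(L_1)\times C_0(L_2))$ with $\|S\|=1$ such that $$|S(x_1,y_1)|=1,\qquad \|x_0-x_1\|<\varepsilon,\qquad \|y_0-y_1\|<\varepsilon,\qquad \|S-B\|<\varepsilon.$$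
   Context: All Banach spaces are complex. For a Banach space $X$, $S_X$ is its unit sphere. For Banach spaces $X,Y$, $\mathcal{B}(X\times Y)$ is the space of all bounded bilinear forms $B:X\times Y\to\mathbb{C}$ (linear in each variable), with norm $\|B\|=\sup\{|B(x,y)|: \|x\|\le 1,\ \|y\|\le 1\}$. For a locally compact Hausdorff space $L$, $C_0(L)$ is the Banach space of complex-valued continuous functions on $L$ vanishing at infinity, with the supremum norm. A pair $(X,Y)$ of Banach spaces has the Bishop-Phelps-Bollobás property for bilinear forms if for every $0<\varepsilon<1$ there is $\eta(\varepsilon)>0$ such that given $B\in\mathcal{B}(X\times Y)$ with $\|B\|=1$ and $(x_0,y_0)\in S_X\times S_Y$ satisfying $|B(x_0,y_0)|>1-\eta(\varepsilon)$, there exist $(x_1,y_1)\in S_X\times S_Y$ and $S\in\mathcal{B}(X\times Y)$ with $\|S\|=1$ satisfying $|S(x_1,y_1)|=1$, $\|x_0-x_1\|<\varepsilon$, $\|y_0-y_1\|<\varepsilon$ and $\|S-B\|<\varepsilon$. *)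

(* Defs.v *)
From HB Require Import structures.
From mathcomp Require Import all_boot all_order all_algebra complex.
From mathcomp Require Import all_classical all_reals topology normedtype.

Set Implicit Arguments.
Unset Strict Implicit.
Unset Printing Implicit Defensive.

Import Order.TTheory GRing.Theory Num.Theory.
Import numFieldNormedType.Exports.

Local Open Scope classical_set_scope.
Local Open Scope ring_scope.
Local Open Scope complex_scope.

(* The libraries put the usual topology only on the alias [R[i]^o]. *)
HB.instance Definition _ (R : rcfType) := NormedModule.copy R[i] R[i]^o.

Section NormR.
Variables (R : realType) (V : normedModType R[i]).
Implicit Types (x y : V) (e : R).

(* The library norm of a complex normed space takes values in the nonnegative
   real axis of [R[i]]; [normR] is the same number as an element of [R]. *)
Definition normR x : R := complex.Re `|x|.

Lemma normRE x : (normR x)%:C = `|x|.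
Proof. by rewrite /normR RRe_real// normr_real. Qed.

Lemma normR_lt x e : (`|x| < e%:C) = (normR x < e).
Proof. by rewrite -normRE ltcR. Qed.

Lemma normR_le x e : (`|x| <= e%:C) = (normR x <= e).
Proof. by rewrite -normRE lecR. Qed.

Lemma normR_ge0 x : 0 <= normR x.
Proof. by rewrite -ler0c normRE. Qed.

Lemma normRD x y : normR (x + y) <= normR x + normR y.
Proof. by rewrite -lecR rmorphD/= !normRE ler_normD. Qed.

Lemma normRB x y : normR (x - y) = normR (y - x).
Proof. by rewrite /normR distrC. Qed.

Lemma normRZ (a : R[i]) x : normR (a *: x) = complex.Re `|a| * normR x.
Proof.
by apply: complexI; rewrite rmorphM/= !normRE normrZ.
Qed.

Lemma normR0_eq0 x : normR x = 0 -> x = 0.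
Proof. by move=> x0; apply: normr0_eq0; rewrite -normRE x0. Qed.

End NormR.

Lemma gt0_complexE (R : rcfType) (e : R[i]) : 0 < e ->
  exists2 r : R, 0 < r & e = r%:C.
Proof.
by case: e => a b; rewrite ltcE/= => /andP[/eqP-> a0]; exists a.
Qed.

Section ComplexComplete.
Variable R : realType.

Let norm_i : `|'i%C : R[i]| = 1.
Proof. by rewrite normc_def/= expr0n/= add0r expr1n sqrtr1. Qed.

Lemma normR_Re (z : R[i]) : `|complex.Re z| <= normR (z : R[i]).
Proof. by rewrite -lecR normRE normc_ge_Re. Qed.

Lemma normR_Im (z : R[i]) : `|complex.Im z| <= normR (z : R[i]).
Proof.
rewrite -normrN -ReiNIm; apply: le_trans (normR_Re _) _; rewrite /normR normrM.
by rewrite norm_i mulr1.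
Qed.

Lemma normR_ReIm (z : R[i]) :
  normR (z : R[i]) <= `|complex.Re z| + `|complex.Im z|.
Proof.
rewrite -lecR normRE [X in `|X|]complexE rmorphD/=.
rewrite (le_trans (ler_normD _ _))// normrM.
rewrite norm_i mul1r.
by rewrite !normc_def/= !expr0n/= !addr0 !sqrtr_sqr.
Qed.

Let cauchy_part (p : R[i] -> R) (F : set_system R[i]) : ProperFilter F ->
  (forall z w, p (z - w) = p z - p w) ->
  (forall z : R[i], `|p z| <= normR (z : R[i])) ->
  cauchy F -> cvg (p @ F).
Proof.
move=> FF pB ple /cauchy_ballP Fc; apply: cauchy_cvg.
apply/cauchy_ballP => e e0.
have eC0 : 0 < e%:C by rewrite ltcR.
have := Fc _ eC0; rewrite !near_simpl => -[[A B] /= [FA FB] AB].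
exists (p @` A, p @` B) => /=.
  by split; [apply: filterS FA|apply: filterS FB] => z Az; exists z.
move=> [u v] /= [[z Az <-] [w Bw <-]].
have := AB (z, w) (conj Az Bw); rewrite /= -!ball_normE/= normR_lt.
by rewrite -pB; apply: le_lt_trans.
Qed.

Lemma complex_complete (F : set_system R[i]) :
  ProperFilter F -> cauchy F -> cvg F.
Proof.
move=> FF Fc.
have /cvg_ex[a Fa] : cvg (@complex.Re R @ F).
  by apply: cauchy_part Fc => [[? ?] [? ?]//|]; exact: normR_Re.
have /cvg_ex[b Fb] : cvg (@complex.Im R @ F).
  by apply: cauchy_part Fc => [[? ?] [? ?]//|]; exact: normR_Im.
apply/cvg_ex; exists (a +i* b : R[i]); apply/fcvgrPdist_lt => _ /gt0_complexE[e e0 ->].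
have e20 : 0 < e / 2 by rewrite divr_gt0.
move/cvgrPdist_lt : Fa => /(_ _ e20) Fa.
move/cvgrPdist_lt : Fb => /(_ _ e20) Fb.
near=> z; rewrite normR_lt (le_lt_trans (normR_ReIm _))//.
rewrite [ltRHS]splitr ltrD//.
  have : `|a - complex.Re z| < e / 2 by near: z.
  by case: (z).
have : `|b - complex.Im z| < e / 2 by near: z.
by case: (z).
Unshelve. all: by end_near. Qed.

HB.instance Definition _ := Uniform_isComplete.Build R[i] complex_complete.

End ComplexComplete.

Section C0.
Variables (R : realType) (L : topologicalType).

Definition vanishes_at_infinity (f : L -> R[i]) :=
  forall e : R, 0 < e ->
    exists2 K : set L, compact K & forall t, ~ K t -> `|f t| < e%:C.

Definition C0_pred : {pred L -> R[i]} :=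
  mem [set f : L -> R[i] | continuous f /\ vanishes_at_infinity f].

Record C0 := MkC0 { C0_fun :> L -> R[i]; C0_funP : C0_fun \in C0_pred }.

HB.instance Definition _ := [isSub for C0_fun].
HB.instance Definition _ := [Choice of C0 by <:].

Lemma C0_submod_closed : submod_closed C0_pred.
Proof.
split.
  apply/mem_set; split; first exact: cst_continuous.
  move=> e e0; exists set0; first exact: compact0.
  by move=> t _; rewrite normr0 ltcR.
move=> a f g /set_mem[/= fc fv] /set_mem[/= gc gv]; apply/mem_set; split.
  by move=> t; apply: cvgD; [apply: cvgZr; exact: fc|exact: gc].
move=> e e0.
pose d := e / 2 / (complex.Re `|a| + 1).
have a0 : 0 <= complex.Re `|a| by exact: normR_ge0 (a : R[i]).
have a1 : 0 < complex.Re `|a| + 1 by rewrite ltr_wpDl.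
have d0 : 0 < d by rewrite /d !divr_gt0.
have e20 : 0 < e / 2 by rewrite divr_gt0.
have [K1 cK1 fK1] := fv _ d0; have [K2 cK2 gK2] := gv _ e20.
exists (K1 `|` K2); first exact: compactU.
move=> t /not_orP[/fK1 ft /gK2 gt].
rewrite normR_lt (le_lt_trans (normRD _ _))// [ltRHS]splitr ler_ltD//.
  rewrite (normRZ a (f t : R[i])) -(@divfK _ (complex.Re `|a| + 1) _ (e / 2)) ?gt_eqF//.
  rewrite -/d mulrC ler_pM ?normR_ge0// ?lerDl//.
  by rewrite ltW// -normR_lt.
by rewrite -normR_lt.
Qed.

HB.instance Definition _ := GRing.isSubmodClosed.Build _ _ C0_pred C0_submod_closed.
HB.instance Definition _ := [SubChoice_isSubLmodule of C0 by <:].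

Implicit Types f g : C0.

Lemma C0_continuous f : continuous f.
Proof. by have /set_mem[] := C0_funP f. Qed.

Lemma C0_vanishes f : vanishes_at_infinity f.
Proof. by have /set_mem[] := C0_funP f. Qed.

(* The set is bounded above ([C0_has_ubound]); it is empty only when [L] is, and
   then its [sup] is 0. *)
Definition C0_norm f : R := sup (range (fun t => normR (f t : R[i]))).

Lemma C0_has_ubound f : has_ubound (range (fun t => normR (f t : R[i]))).
Proof.
have [K cK fK] := C0_vanishes f ltr01.
have nfc : continuous (fun t => normR (f t : R[i])).
  move=> t; apply/cvgrPdist_lt => e e0.
  have eC0 : 0 < e%:C by rewrite ltcR.
  have /cvgrPdist_lt/(_ _ eC0) := @C0_continuous f t.
  apply: filterS => s; rewrite normR_lt; apply: le_lt_trans.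
  rewrite ler_norml; apply/andP; split.
    rewrite lerBrDr addrC lerBlDr addrC -normRB.
    by rewrite -[X in normR X](subrK (f t)) normRD.
  rewrite lerBlDr.
  by rewrite -[X in normR X <= _](subrK (f s)) normRD.
have /compact_bounded[M [_ HM]] :
    compact [set normR (f t : R[i]) | t in K].
  by apply: continuous_compact => //; exact: continuous_subspaceT.
exists (Num.max (M + 1) 1) => _ [t _ <-].
have [Kt|/fK] := pselect (K t).
  rewrite le_max (le_trans (ler_norm _))// (HM (M + 1)) ?ltrDl//.
  by exists t.
by rewrite normR_lt le_max => /ltW ->; rewrite orbT.
Qed.

Lemma C0_norm_ub f t : normR (f t : R[i]) <= C0_norm f.
Proof. by apply: (ub_le_sup (C0_has_ubound f)); exists t. Qed.

Lemma C0_norm_le f M : 0 <= M -> (forall t, normR (f t : R[i]) <= M) ->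
  C0_norm f <= M.
Proof.
move=> M0 fM; rewrite /C0_norm.
have [E0|/set0P/negP/negPn/eqP ->] :=
    pselect (range (fun t => normR (f t : R[i])) !=set0); last by rewrite sup0.
by apply: ge_sup => // _ [t _ <-].
Qed.

Lemma C0_norm_ge0 f : 0 <= C0_norm f.
Proof.
have [[t _]|L0] := pselect (exists t : L, True).
  exact: le_trans (normR_ge0 _) (C0_norm_ub f t).
suff E0 : range (fun t => normR (f t : R[i])) = set0 by rewrite /C0_norm E0 sup0.
by apply/seteqP; split=> // r [t _ _]; case: L0; exists t.
Qed.

Lemma C0_normD f g : C0_norm (f + g) <= C0_norm f + C0_norm g.
Proof.
apply: C0_norm_le => [|t]; first by rewrite addr_ge0// C0_norm_ge0.
by rewrite (le_trans (normRD _ _))// lerD// C0_norm_ub.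
Qed.

Let C0_normZ_le (a : R[i]) f : C0_norm (a *: f) <= complex.Re `|a| * C0_norm f.
Proof.
have a0 : 0 <= complex.Re `|a| by exact: normR_ge0 (a : R[i]).
apply: C0_norm_le => [|t]; first by rewrite mulr_ge0// C0_norm_ge0.
by rewrite (normRZ a (f t : R[i])) ler_wpM2l// C0_norm_ub.
Qed.

Lemma C0_normZ (a : R[i]) f : (C0_norm (a *: f))%:C = `|a| * (C0_norm f)%:C.
Proof.
have [->|a0] := eqVneq a 0.
  rewrite normr0 mul0r; congr _%:C; apply/le_anti; rewrite C0_norm_ge0 andbT.
  by rewrite (le_trans (C0_normZ_le _ _))// normr0 mul0r.
rewrite -(RRe_real (normr_real a)) -rmorphM/=; congr _%:C.
apply/le_anti; rewrite C0_normZ_le/=.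
have := C0_normZ_le a^-1 (a *: f); rewrite scalerA mulVf// scale1r.
have na : 0 < complex.Re `|a|.
  by rewrite -ltcR (RRe_real (normr_real a)) normr_gt0.
rewrite -ler_pdivlMl//; congr (_ <= _ * _).
by apply: complexI; rewrite fmorphV !(RRe_real (normr_real _)) normfV.
Qed.

Lemma C0_norm0_eq0 f : (C0_norm f)%:C = 0 -> f = 0.
Proof.
move=> [f0]; apply: val_inj; apply/funext => t /=; apply: (@normR0_eq0 R R[i]).
by apply/le_anti; rewrite normR_ge0 andbT -f0 C0_norm_ub.
Qed.

Let C0_normDC f g : (C0_norm (f + g))%:C <= (C0_norm f)%:C + (C0_norm g)%:C.
Proof. by rewrite -rmorphD lecR C0_normD. Qed.

HB.instance Definition _ :=
  Lmodule_isNormed.Build R[i] C0 C0_normDC C0_normZ C0_norm0_eq0.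

Lemma C0_normE f : `|f| = (C0_norm f)%:C.
Proof. by []. Qed.

Lemma C0_complete (F : set_system C0) : ProperFilter F -> cauchy F -> cvg F.
Proof.
move=> FF /cauchy_ballP Fc.
have Fev e : 0 < e -> exists2 A : set C0, F A & exists2 B : set C0, F B &
    forall f g t, A f -> B g -> normR (f t - g t : R[i]) < e.
  move=> e0; have eC0 : 0 < e%:C by rewrite ltcR.
  have := Fc _ eC0; rewrite !near_simpl => -[[A B] /= [FA FB] AB].
  exists A => //; exists B => // f g t Af Bg.
  have := AB (f, g) (conj Af Bg); rewrite /= -!ball_normE/= C0_normE ltcR.
  exact: le_lt_trans (C0_norm_ub (f - g) t).
have evc t : cvg ((fun f : C0 => f t) @ F).
  apply: cauchy_cvg; apply/cauchy_ballP => _ /gt0_complexE[e e0 ->].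
  have [A FA [B FB AB]] := Fev _ e0.
  exists ((fun f : C0 => f t) @` A, (fun f : C0 => f t) @` B) => /=.
    split.
      by apply: (@filterS _ F _ A _ _ FA) => f Af; exists f.
    by apply: (@filterS _ F _ B _ _ FB) => f Bf; exists f.
  move=> [_ _] /= [[f Af <-] [g Bg <-]].
  by rewrite -!ball_normE/= normR_lt; exact: AB.
pose l t : R[i] := lim ((fun f : C0 => f t) @ F).
have Fl e : 0 < e -> F [set f : C0 | forall t, normR (l t - f t : R[i]) <= e].
  move=> e0; have [A FA [B FB AB]] := Fev _ e0.
  apply: filterS FA => f Af t; apply/ler_addgt0Pr => d d0.
  have dC0 : 0 < d%:C by rewrite ltcR.
  have /cvgrPdist_lt/(_ _ dC0) Fd := evc t.
  have [g [Bg gd]] := filter_ex (filterI FB Fd).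
  rewrite -[X in normR X](subrKA (g t : R[i])) (le_trans (normRD _ _))//.
  rewrite addrC lerD//; last by rewrite ltW// -normR_lt.
  by rewrite normRB ltW// AB.
have lC0 : l \in C0_pred.
  apply/mem_set; split.
    move=> t; apply/cvgrPdist_lt => _ /gt0_complexE[e e0 ->].
    have e30 : 0 < e / 3 by rewrite divr_gt0.
    have eC0 : 0 < (e / 3)%:C by rewrite ltcR.
    have [f lf] := filter_ex (Fl _ e30).
    have /cvgrPdist_lt/(_ _ eC0) := @C0_continuous f t.
    apply: filterS => s fts; rewrite normR_lt.
    have -> : l t - l s = (l t - f t) + (f t - f s) + (f s - l s).
      by rewrite !addrA !subrK.
    rewrite (le_lt_trans (normRD _ _))//.
    have -> : e = (e / 3 + e / 3) + e / 3.
      rewrite -!mulrDl -{2}(mulr1n e) -!mulrSr.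
      by rewrite -(mulr_natr e 3) mulfK// pnatr_eq0.
    rewrite ltr_leD//; last by rewrite normRB lf.
    rewrite (le_lt_trans (normRD _ _))// ler_ltD ?lf//.
    by rewrite -normR_lt.
  move=> e e0; have e20 : 0 < e / 2 by rewrite divr_gt0.
  have [f lf] := filter_ex (Fl _ e20).
  have [K cK fK] := C0_vanishes f e20.
  exists K => // t /fK; rewrite !normR_lt => ft.
  rewrite -[X in normR X](subrK (f t : R[i])) (le_lt_trans (normRD _ _))//.
  by rewrite [ltRHS]splitr ler_ltD// lf.
apply/cvg_ex; exists (MkC0 lC0); apply/fcvgrPdist_lt => _ /gt0_complexE[e e0 ->].
have e20 : 0 < e / 2 by rewrite divr_gt0.
apply: filterS (Fl _ e20) => f lf /=; rewrite C0_normE ltcR.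
apply: (@le_lt_trans _ _ (e / 2)); last by rewrite ltr_pdivrMr// ltr_pMr// ltr1n.
by apply: C0_norm_le => [|t]; [exact: ltW|exact: lf].
Qed.

HB.instance Definition _ := Uniform_isComplete.Build C0 C0_complete.

End C0.
Section BishopPhelpsBollobas.
Variable R : realType.

Section BoundedForms.
Variables X Y : completeNormedModType R[i].

Definition bform_values (B : X -> Y -> R[i]) : set R :=
  [set r | exists x y, [/\ `|x| <= 1, `|y| <= 1 & r = normR (B x y)]].

Definition bounded_bform (B : X -> Y -> R[i]) := has_ubound (bform_values B).

(* This is the norm only for bounded forms: [sup] is 0 on unbounded sets. *)
Definition bform_norm (B : X -> Y -> R[i]) : R := sup (bform_values B).

End BoundedForms.

Definition BPB_bilinear_with (eps eta : R) (X Y : completeNormedModType R[i]) :=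
  forall (B : {bilinear X -> Y -> R[i] | *%R & *%R}) (x0 : X) (y0 : Y),
    bounded_bform B -> bform_norm B = 1 ->
    `|x0| = 1 -> `|y0| = 1 -> (1 - eta)%:C < `|B x0 y0| ->
  exists (x1 : X) (y1 : Y) (S : {bilinear X -> Y -> R[i] | *%R & *%R}),
    [/\ `|x1| = 1 /\ `|y1| = 1,
        bounded_bform S /\ bform_norm S = 1,
        `|S x1 y1| = 1,
        `|x0 - x1| < eps%:C /\ `|y0 - y1| < eps%:C &
        bform_norm (fun x y => S x y - B x y) < eps].

Definition BPBp_bilinear (X Y : completeNormedModType R[i]) :=
  forall eps : R, 0 < eps < 1 ->
    exists2 eta : R, 0 < eta & BPB_bilinear_with eps eta X Y.

End BishopPhelpsBollobas.

(* Main.v *)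
Require Import Defs.
From HB Require Import structures.
From mathcomp Require Import all_boot all_order all_algebra complex.
From mathcomp Require Import all_classical all_reals topology normedtype.
From mathcomp Require Import ring lra.

Set Implicit Arguments.
Unset Strict Implicit.
Unset Printing Implicit Defensive.

Import Order.TTheory GRing.Theory Num.Theory.
Import numFieldNormedType.Exports.

Local Open Scope classical_set_scope.
Local Open Scope ring_scope.
Local Open Scope complex_scope.

(** A form [B] of norm 1 that nearly attains its norm at [(x0, y0)] is improved
    step by step: each step moves the form and the points by at most [eps / 2^(n+2)]
    and makes the new value as close to 1 as the next step requires, so that the
    limits attain the norm exactly. One step ([BPB_step]) rests on three ideas,
    in which all auxiliary functions are explicit continuous expressions in the given
    ones.

    Concentration. The dual of [C0 R L2] is an L1-space, hence uniformly convex in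
    the complex sense: when [B u v] is nearly 1, [B w] is small for every [w] that
    fits into the slack of [u], i.e. [|w| <= 1 - |u|] pointwise. This is
    [form_slack_le], proved by testing against [v + s/2 (y - v^2 y')], [y'] being the
    conjugate of [y]: this leaves the unit ball only to second order in [s] but
    changes the value to first order.

    Perturbation. Put [S x y = B x y + a B(x, y0) B(x0, y)] and let [(x1, y1)] be
    nearly maximal for [S]. After a rotation of [x1] and [y1], the rank-one term
    forces all four numbers [B xi yj] to be close to 1 ([perturbed_near_max]), and
    hence the value of [B] at the two midpoints. The midpoint of [x0] and [x1] has
    slack wherever [x1] is far from [x0], so by concentration [B], and therefore
    [S], is negligible on functions living there ([form_far_le]).

    Rerouting. The point [x1] may be far from [x0] in norm. Truncating [x1 - x0]
    gives a point [x] near [x0] that differs from [x1] only in the far region. With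
    [k] a cutoff equal to 1 where [x] and [x1] differ, the linear contraction
    [P f = (1 - k) f + k Lam(f) x1], with [Lam] a functional of norm at most 1 nearly
    equal to 1 at [x], maps [x] almost to [x1] and moves functions only in the far
    region ([reroute]). So [S (P x) (Q y)] is a form close to [S], of norm at most
    that of [S], whose value at the new points is as nearly maximal as that of [S]
    at [(x1, y1)]. Merely restricting [S] to the region near [x0] could lose
    an amount that does not shrink with the precision required of the step. *)

(** * Complex numbers *)

Section NormR.
Variables (R : realType) (V : normedModType R[i]).
Implicit Type x : V.

Lemma normR0 : normR (0 : V) = 0.
Proof. by rewrite /normR normr0. Qed.

Lemma normRN x : normR (- x) = normR x.
Proof. by rewrite /normR normrN. Qed.

Lemma normR_scale (a : R[i]) x : normR (a *: x) = normR a * normR x.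
Proof. exact: normRZ. Qed.

Lemma normR_le1 x : (`|x| <= 1) = (normR x <= 1).
Proof. by rewrite -normR_le rmorph1. Qed.

End NormR.

Section ComplexNumbers.
Variable R : realType.
Implicit Types (z w : R[i]) (r : R).

Lemma normR1 : normR (1 : R[i]) = 1.
Proof. by rewrite /normR normr1. Qed.

Lemma normRM z w : normR (z * w) = normR z * normR w.
Proof. exact: (normRZ z (w : R[i])). Qed.

Lemma normRr r : normR (r%:C) = `|r|.
Proof. by rewrite /normR normc_def/= expr0n/= addr0 sqrtr_sqr. Qed.

Lemma Re_le_normR z : complex.Re z <= normR z.
Proof. exact: le_trans (ler_norm _) (normR_Re z). Qed.

Lemma Re_realM r z : complex.Re (r%:C * z) = r * complex.Re z.
Proof. by case: z => b c /=; rewrite mul0r subr0. Qed.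

Lemma normR_sqr z : normR z ^+ 2 = complex.Re z ^+ 2 + complex.Im z ^+ 2.
Proof. by rewrite /normR normc_def/= sqr_sqrtr// addr_ge0// sqr_ge0. Qed.

Lemma normR_conj z : normR (conjc z) = normR z.
Proof.
by rewrite /normR !normc_def/=; case: z => a b /=; rewrite sqrrN.
Qed.

Lemma normR_sqr_le z r : 0 <= r -> normR z ^+ 2 <= r ^+ 2 -> normR z <= r.
Proof. by move=> r0; rewrite ler_sqr// nnegrE normR_ge0. Qed.

Lemma unimodularP z : exists2 c : R[i], normR c = 1 & c * z = (normR z)%:C.
Proof.
have [->|z0] := eqVneq z 0; first by exists 1; rewrite ?mulr0 ?normR0 ?normR1.
have nz : normR z != 0 by apply: contra z0 => /eqP/normR0_eq0 ->.
have nz0 : 0 < normR z by rewrite lt_def nz normR_ge0.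
exists ((normR z)%:C / z); last by rewrite divfK.
rewrite normRM normRr ger0_norm ?normR_ge0//.
by apply: (mulIf nz); rewrite -mulrA -normRM mulVf// mul1r normR1 mulr1.
Qed.

(** With [y'] the conjugate of [y], [v^2 y' = v (v y')], so the vector is [v] times
    [1] plus a purely imaginary number of size at most [s], whose modulus exceeds 1
    only to second order, plus a multiple of [y] that is controlled by the room
    [1 - |v|]. *)
Lemma normR_tilt_le (v y : R[i]) (s : R) :
  0 <= s <= 1 -> normR v <= 1 -> normR y <= 1 ->
  normR (v + (s / 2)%:C * (y - v * v * conjc y)) <= 1 + s ^+ 2.
Proof.
move=> /andP[s0 s1] v1 y1.
set q := complex.Im (v * conjc y).
have -> : v + (s / 2)%:C * (y - v * v * conjc y) =
   v * (1 -i* (s * q)) + (s / 2 * (1 - normR v ^+ 2))%:C * y.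
  rewrite /q normR_sqr; case: (v) (y) => [a b] [c d] /=; simpc.
  by congr (_ +i* _); field.
have q1 : q ^+ 2 <= 1.
  have := normR_sqr (v * conjc y); rewrite normRM normR_conj -/q => h.
  rewrite (@le_trans _ _ ((normR v * normR y) ^+ 2))//.
    by rewrite h lerDr sqr_ge0.
  by rewrite expr_le1 ?mulr_ge0 ?mulr_ile1 ?normR_ge0.
have h1 : normR (1 -i* (s * q)) <= 1 + s ^+ 2 / 2.
  apply: normR_sqr_le; first by nra.
  by rewrite normR_sqr/=; nra.
apply: le_trans (normRD _ _) _; rewrite !normRM normRr.
have v0 := normR_ge0 v; have y0 := normR_ge0 y.
have c0 : 0 <= s / 2 * (1 - normR v ^+ 2).
  by rewrite mulr_ge0 ?divr_ge0// subr_ge0 expr_le1.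
rewrite (ger0_norm c0).
have h2 : normR v * normR (1 -i* (s * q)) <= normR v * (1 + s ^+ 2 / 2).
  by rewrite ler_wpM2l.
have h3 : s / 2 * (1 - normR v ^+ 2) * normR y <= s / 2 * (1 - normR v ^+ 2).
  by rewrite ler_piMr.
apply: le_trans (lerD h2 h3) _.
move: (normR v) v0 v1 {c0 h2 h3} => n n0 n1.
have h4 : s / 2 * (1 - n ^+ 2) <= 1 - n.
  have h5 : 0 <= (1 - s) * (1 - n ^+ 2) by rewrite mulr_ge0 ?subr_ge0// expr_le1.
  have h6 : 0 <= (1 - n) ^+ 2 by exact: sqr_ge0.
  lra.
have h5 : 0 <= (1 - n) * s ^+ 2 by rewrite mulr_ge0 ?subr_ge0 ?sqr_ge0.
have h6 : 0 <= s ^+ 2 by exact: sqr_ge0.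
lra.
Qed.

(** By the parallelogram law, the slack of a midpoint is at least quadratic in the
    distance between the two points. *)
Lemma normR_midpoint_le (x y : R[i]) : normR x <= 1 -> normR y <= 1 ->
  normR ((2^-1)%:C * (x + y)) + normR (y - x) ^+ 2 / 8 <= 1.
Proof.
move=> x1 y1; set m := normR _.
have m0 : 0 <= m := normR_ge0 _.
have hp : 4 * m ^+ 2 + normR (y - x) ^+ 2 = 2 * normR x ^+ 2 + 2 * normR y ^+ 2.
  by rewrite /m !normR_sqr; case: (x) (y) => [a b] [c d] /=; field.
have hx : normR x ^+ 2 <= 1 by rewrite expr_le1 ?normR_ge0.
have hy : normR y ^+ 2 <= 1 by rewrite expr_le1 ?normR_ge0.
have h := sqr_ge0 (1 - m); lra.
Qed.

End ComplexNumbers.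

(** * Functions vanishing at infinity *)

Section ContinuousFunctions.
Variables (R : realType) (L : topologicalType).

Lemma normR_continuous (f : L -> R[i]) : continuous f ->
  continuous (fun t => normR (f t)).
Proof.
move=> fc t; apply/cvgrPdist_lt => e e0.
have eC0 : 0 < e%:C by rewrite ltcR.
have /cvgrPdist_lt/(_ _ eC0) := fc t.
apply: filterS => s; rewrite normR_lt; apply: le_lt_trans.
have h1 : normR (f t) <= normR (f t - f s) + normR (f s).
  by rewrite -[X in normR X <= _](subrK (f s)) normRD.
have h2 : normR (f s) <= normR (f s - f t) + normR (f t).
  by rewrite -[X in normR X <= _](subrK (f t)) normRD.
rewrite normRB in h2; rewrite ler_norml; lra.
Qed.

Lemma real_complex_continuous (f : L -> R) : continuous f ->
  continuous (fun t => (f t)%:C : R[i]).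
Proof.
move=> fc t; apply/cvgrPdist_lt => _ /gt0_complexE[e e0 ->].
have /cvgrPdist_lt/(_ _ e0) := fc t.
by apply: filterS => s; rewrite normR_lt -rmorphB normRr.
Qed.

Lemma conjc_continuous (f : L -> R[i]) : continuous f ->
  continuous (fun t => conjc (f t)).
Proof.
move=> fc t; apply/cvgrPdist_lt => _ /gt0_complexE[e e0 ->].
have eC0 : 0 < e%:C by rewrite ltcR.
have /cvgrPdist_lt/(_ _ eC0) := fc t.
by apply: filterS => s; rewrite !normR_lt -rmorphB normR_conj.
Qed.

Lemma complexM_continuous (f g : L -> R[i]) : continuous f -> continuous g ->
  continuous (fun t => f t * g t).
Proof. by move=> fc gc t; apply: cvgM; [exact: fc|exact: gc]. Qed.

Implicit Types f g : C0 R L.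

Lemma C0_le_normR f t : normR (f t) <= normR f.
Proof. exact: C0_norm_ub. Qed.

Lemma normR_C0_le f (M : R) : 0 <= M -> (forall t, normR (f t) <= M) ->
  normR f <= M.
Proof. exact: C0_norm_le. Qed.

Lemma C0_ext f g : f =1 g -> f = g.
Proof. by move=> fg; apply: val_inj; apply/funext. Qed.

Lemma C0_dominated f (g : L -> R[i]) : continuous g ->
  (forall t, normR (g t) <= normR (f t)) -> g \in @C0_pred R L.
Proof.
move=> gc gf; apply/mem_set; split=> // e e0.
have [K cK fK] := C0_vanishes f e0.
exists K => // t /fK; rewrite !normR_lt; apply: le_lt_trans; exact: gf.
Qed.

Section Multiplier.
Variables (a : L -> R[i]).
Hypotheses (ac : continuous a) (a1 : forall t, normR (a t) <= 1).

Lemma multiplier_subproof f : (fun t => a t * f t) \in @C0_pred R L.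
Proof.
apply: (@C0_dominated f).
  exact: (complexM_continuous ac (@C0_continuous R L f)).
by move=> t; rewrite normRM ler_piMl ?normR_ge0.
Qed.

Definition multiplier f : C0 R L := MkC0 (multiplier_subproof f).

Lemma multiplier_is_linear : linear multiplier.
Proof. by move=> c f g; apply: C0_ext => t /=; rewrite mulrDr mulrCA. Qed.

HB.instance Definition _ := GRing.isLinear.Build R[i] (C0 R L) (C0 R L) *:%R
  multiplier multiplier_is_linear.

End Multiplier.

End ContinuousFunctions.

(** * Bounded bilinear forms *)

Section Forms.
Variables (R : realType) (X Y : normedModType R[i]).
Implicit Types (B : {bilinear X -> Y -> R[i] | *%R & *%R}).

(** Bilinearity in the plain shape that [ring] can prove for explicit formulas;
    [form_of] turns it into the bundled structure. *)
Definition form_axiom (B : X -> Y -> R[i]) :=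
  (forall a x x' y, B (a *: x + x') y = a * B x y + B x' y) /\
  (forall a x y y', B x (a *: y + y') = a * B x y + B x y').

Section Pack.
Variables (B : X -> Y -> R[i]) (HB : form_axiom B).

Let m : bilinear_for (GRing.Scale.Law.clone _ _ *%R _)
  (GRing.Scale.Law.clone _ _ *%R _) B.
Proof. by split=> [y a x x'|x a y y'] /=; [rewrite HB.1|rewrite HB.2]. Qed.

Definition form_mixin := bilinear_isBilinear.Build R[i] X Y R[i] _ _ B m.

Definition form_of : {bilinear X -> Y -> R[i] | *%R & *%R} := HB.pack B form_mixin.

End Pack.

Lemma form_le_ball B (c : R) :
  (forall x y, normR x <= 1 -> normR y <= 1 -> normR (B x y) <= c) ->
  forall x y, normR (B x y) <= c * normR x * normR y.
Proof.
move=> Bc x y.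
have [->|x0] := eqVneq x 0; first by rewrite linear0l !normR0 mulr0 mul0r.
have [->|y0] := eqVneq y 0; first by rewrite linear0 !normR0 mulr0.
have nz (V : normedModType R[i]) (v : V) : v != 0 -> 0 < normR v.
  move=> v0; rewrite lt_def normR_ge0 andbT.
  by apply: contra v0 => /eqP/normR0_eq0->.
have [xp yp] := (nz _ _ x0, nz _ _ y0).
have inv (V : normedModType R[i]) (v : V) :
    0 < normR v -> normR (((normR v)^-1)%:C *: v) = 1.
  move=> v0; rewrite normR_scale normRr ger0_norm ?invr_ge0 ?ltW//.
  by rewrite mulVf// gt_eqF.
have := Bc (((normR x)^-1)%:C *: x) (((normR y)^-1)%:C *: y).
rewrite !inv// lexx => /(_ isT isT).
rewrite linearZl linearZ/= !normRM !normRr !ger0_norm ?invr_ge0 ?normR_ge0//.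
by rewrite mulrA -invfM mulrC ler_pdivrMr ?mulr_gt0// mulrA.
Qed.

End Forms.

Section NearMax.
Variables (R : realType) (X Y : completeNormedModType R[i]).
Variable B : {bilinear X -> Y -> R[i] | *%R & *%R}.

Lemma bounded_bform_le (M : R) : 0 <= M ->
  (forall x y, normR (B x y) <= M * normR x * normR y) -> bounded_bform B.
Proof.
move=> M0 BM; exists M => _ [x [y [x1 y1 ->]]].
rewrite !normR_le1 in x1 y1.
apply: le_trans (BM x y) _; rewrite -mulrA ler_piMr ?mulr_ile1 ?normR_ge0//.
Qed.

Lemma bform_norm_ub x y : bounded_bform B -> normR x <= 1 -> normR y <= 1 ->
  normR (B x y) <= bform_norm B.
Proof.
by move=> Bb x1 y1; apply: (ub_le_sup Bb); exists x, y; rewrite !normR_le1.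
Qed.

Lemma le_bform_norm : bounded_bform B ->
  forall x y, normR (B x y) <= bform_norm B * normR x * normR y.
Proof. by move=> Bb; apply: form_le_ball => x y; exact: bform_norm_ub. Qed.

Lemma bform_norm_le (D : X -> Y -> R[i]) (M : R) :
  (forall x y, normR x <= 1 -> normR y <= 1 -> normR (D x y) <= M) ->
  bform_norm D <= M.
Proof.
move=> DM; apply: ge_sup.
  by exists (normR (D 0 0)), 0, 0; rewrite !normr0 !ler01.
by move=> _ [x [y [x1 y1 ->]]]; apply: DM; rewrite -normR_le1.
Qed.

Lemma bform_near_max (tau : R) : bounded_bform B -> 0 < tau ->
  exists x y, [/\ normR x <= 1, normR y <= 1 & bform_norm B - tau < normR (B x y)].
Proof.
move=> Bb tau0.
have hs : has_sup (bform_values B).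
  by split=> //; exists (normR (B 0 0)), 0, 0; rewrite !normr0 !ler01.
have [_ [x [y [x1 y1 ->]]] h] := sup_adherent tau0 hs.
by exists x, y; rewrite -!normR_le1.
Qed.

End NearMax.

Section Transforms.
Variables (R : realType) (X Y : normedModType R[i]).
Implicit Types (B : {bilinear X -> Y -> R[i] | *%R & *%R}).

Lemma flip_axiom B : form_axiom (fun y x => B x y).
Proof. by split=> *; rewrite (linearDl, linearDr) (linearZl, linearZr). Qed.

Definition flip B := form_of (flip_axiom B).

Lemma scale_axiom B (c : R[i]) : form_axiom (fun x y => c * B x y).
Proof.
split=> [b x x' y|b x y y'].
  by rewrite linearDl linearZl/= mulrDr mulrCA.
by rewrite linearDr linearZr/= mulrDr mulrCA.
Qed.

Definition scale_form B c := form_of (scale_axiom B c).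

Lemma sub_axiom B B' : form_axiom (fun x y => B x y - B' x y).
Proof.
split=> [b x x' y|b x y y'].
  rewrite !linearDl !linearZl/=; ring.
rewrite !linearDr !linearZr/=; ring.
Qed.

Definition sub_form B B' := form_of (sub_axiom B B').

Lemma comp_axiom B (P : {linear X -> X}) (Q : {linear Y -> Y}) :
  form_axiom (fun x y => B (P x) (Q y)).
Proof.
split=> [b x x' y|b x y y'].
  by rewrite linearD linearZ linearDl linearZl.
by rewrite linearD linearZ linearDr linearZr.
Qed.

Definition comp_form B P Q := form_of (comp_axiom B P Q).

Lemma perturbed_axiom B (a : R) x0 y0 :
  form_axiom (fun x y => B x y + a%:C * (B x y0 * B x0 y)).
Proof.
split=> [b x x' y|b x y y'].
  rewrite !linearDl !linearZl/=; ring.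
rewrite !linearDr !linearZr/=; ring.
Qed.

(** The rank-one term rewards the points whose values under [B _ y0] and [B x0 _] are
    large and in phase with those of [x0] and [y0]. *)
Definition perturbed B a x0 y0 := form_of (perturbed_axiom B a x0 y0).

Lemma perturbed_le B (a M : R) x0 y0 x y :
  (forall x y, normR (B x y) <= normR x * normR y) -> normR y0 <= 1 ->
  normR x0 <= 1 -> 0 <= a <= 1 -> normR y <= 1 ->
  normR (B x y) <= M -> normR (B x y0) <= M ->
  normR (perturbed B a x0 y0 x y) <= (1 + a) * M.
Proof.
move=> B1 y01 x01 /andP[a0 a1] y1 h1 h2.
apply: le_trans (normRD _ _) _; rewrite !normRM normRr ger0_norm//.
have h3 : normR (B x0 y) <= 1.
  by apply: le_trans (B1 _ _) _; rewrite mulr_ile1 ?normR_ge0.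
have : normR (B x y0) * normR (B x0 y) <= M.
  by apply: le_trans h2; rewrite ler_piMr ?normR_ge0.
move=> h4.
have : a * (normR (B x y0) * normR (B x0 y)) <= a * M by rewrite ler_wpM2l.
lra.
Qed.

End Transforms.

(** * Rerouting *)

Section Rerouting.
Variables (R : realType) (L : topologicalType).
Implicit Types (f z x : C0 R L) (t : L).

(** A cutoff that is 1 at distance at least [rho]. It is quadratic because it has to be
    dominated by the slack of the midpoint, see [normR_midpoint_le]. *)
Definition far (rho : R) x0 x1 t : R :=
  Num.min 1 (normR (x1 t - x0 t) ^+ 2 / rho ^+ 2).

Section Far.
Variables (rho : R) (x0 x1 : C0 R L).
Hypothesis rho_gt0 : 0 < rho.

Let dist_continuous : continuous (fun t => normR (x1 t - x0 t)).
Proof. exact/normR_continuous/(@C0_continuous R L (x1 - x0)). Qed.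

Lemma far_itv t : 0 <= far rho x0 x1 t <= 1.
Proof.
by rewrite /far le_min ler01 ge_min lexx/= divr_ge0// sqr_ge0.
Qed.

Lemma far_continuous : continuous (far rho x0 x1).
Proof.
move=> t; apply: (@continuous_min R L (cst 1)); first exact: cvg_cst.
apply: cvgM; last exact: cvg_cst.
by apply: cvgM; exact: dist_continuous.
Qed.

Lemma far_le1 t : normR ((far rho x0 x1 t)%:C) <= 1.
Proof. by have /andP[? ?] := far_itv t; rewrite normRr ger0_norm. Qed.

Let clip t : R := rho / Num.max rho (normR (x1 t - x0 t)).

Let clip_itv t : 0 <= clip t <= 1.
Proof.
have h : 0 < Num.max rho (normR (x1 t - x0 t)) by rewrite lt_max rho_gt0.
rewrite /clip divr_ge0 ?(ltW rho_gt0) ?(ltW h)//=.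
by rewrite ler_pdivrMr// mul1r le_max lexx.
Qed.

Let clip_continuous : continuous clip.
Proof.
move=> t; apply: cvgM; first exact: cvg_cst.
apply: cvgV; first by rewrite gt_eqF// lt_max rho_gt0.
apply: (@continuous_max R L (cst rho)); first exact: cvg_cst.
exact: dist_continuous.
Qed.

Let clip_le1 t : normR ((clip t)%:C) <= 1.
Proof. by have /andP[? ?] := clip_itv t; rewrite normRr ger0_norm. Qed.

(** Truncating [x1 - x0] at modulus [rho] leaves it unchanged at distance less than
    [rho], and [far] is 1 everywhere else. *)
Lemma clipping : normR x0 <= 1 -> normR x1 <= 1 ->
  exists x, [/\ normR x <= 1, normR (x - x0) <= rho &
    forall t, (1 - (far rho x0 x1 t)%:C) * (x t - x1 t) = 0].
Proof.
move=> n0 n1.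
pose x : C0 R L := x0 +
  multiplier (real_complex_continuous clip_continuous) clip_le1 (x1 - x0).
have xE t : x t = x0 t + (clip t)%:C * (x1 t - x0 t) by [].
exists x; split.
- apply: normR_C0_le => // t; have /andP[c0 c1] := clip_itv t.
  have -> : x t = (1 - clip t)%:C * x0 t + (clip t)%:C * x1 t.
    by rewrite xE rmorphB rmorph1; ring.
  apply: le_trans (normRD _ _) _; rewrite !normRM !normRr.
  rewrite !ger0_norm ?subr_ge0//.
  have h0 := le_trans (C0_le_normR x0 t) n0.
  have h1 := le_trans (C0_le_normR x1 t) n1.
  have : (1 - clip t) * normR (x0 t) <= 1 - clip t by rewrite ler_piMr ?subr_ge0.
  have : clip t * normR (x1 t) <= clip t by rewrite ler_piMr.
  lra.
- apply: normR_C0_le; first exact: ltW.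
  move=> t; have -> : (x - x0) t = (clip t)%:C * (x1 t - x0 t).
    by rewrite [LHS](_ : _ = x t - x0 t)// xE; ring.
  have /andP[c0 c1] := clip_itv t.
  rewrite normRM normRr ger0_norm// /clip mulrAC ler_pdivrMr ?lt_max ?rho_gt0//.
  by rewrite ler_pM2l// le_max lexx orbT.
- move=> t; have [h|h] := ltP (normR (x1 t - x0 t)) rho.
    have -> : x t = x1 t.
      rewrite xE /clip max_l ?ltW// divff ?gt_eqF// mul1r; ring.
    by rewrite subrr mulr0.
  suff -> : far rho x0 x1 t = 1 by rewrite subrr mul0r.
  rewrite /far min_l// ler_pdivlMr ?exprn_gt0// mul1r.
  by rewrite ler_sqr// nnegrE ?normR_ge0// ltW.
Qed.

End Far.

(** Here [P f = f - k f + Lam f * k x1] with [k] the cutoff [far], and [Lam] is, up to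
    a phase, [f |-> phi (f - k f)] divided by a bound of its norm. That bound is where
    the near maximality of [x1] enters: for [f] in the unit ball and [d] of modulus 1,
    [d (f - k f) + k x1] is again in the unit ball, so the part [phi (f - k f)] cannot
    exceed what [x1] achieves on [1 - k] by more than the defect [tau] of [x1].
    The bound [c] on the far region ensures that [x1] achieves at least 1/2 there, so
    that [Lam x] is within [2 tau] of 1. *)
Lemma reroute (phi : {scalar C0 R L}) (x0 x1 : C0 R L) (rho N tau c : R) :
    0 < rho -> 0 < tau -> normR x0 <= 1 -> normR x1 <= 1 ->
    (forall f, normR (phi f) <= N * normR f) -> N - tau <= normR (phi x1) ->
    (forall z, (forall t, normR (z t) <= far rho x0 x1 t) -> normR (phi z) <= c) ->
    2^-1 <= N - tau - c ->
  exists (x : C0 R L) (P : {linear C0 R L -> C0 R L}),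
    [/\ normR x <= 1, normR (x - x0) <= rho,
        (forall f, normR (P f) <= normR f), normR (P x - x1) <= 2 * tau &
        forall f, normR f <= 1 ->
          forall t, normR ((P f - f) t) <= 2 * far rho x0 x1 t].
Proof.
move=> rho0 tau0 n0 n1 phiN phi1 phic hN.
have [x [xn xd xk]] := clipping rho0 n0 n1.
pose k t := far rho x0 x1 t.
have kC := real_complex_continuous (@far_continuous rho x0 x1).
have k1 := @far_le1 rho x0 x1.
pose K : {linear C0 R L -> C0 R L} := multiplier kC k1.
have KE f t : K f t = (k t)%:C * f t by [].
have Hx : x - K x = x1 - K x1.
  apply: C0_ext => t.
  rewrite [LHS](_ : _ = x t - K x t)// [RHS](_ : _ = x1 t - K x1 t)// !KE.
  have := xk t; rewrite -/(k t) => h.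
  by apply/eqP; rewrite -subr_eq0 -h; apply/eqP; ring.
set A := normR (phi (x1 - K x1)).
have kb f t : normR f <= 1 -> normR (K f t) <= k t.
  move=> f1; rewrite KE normRM normRr; have /andP[k0 _] := far_itv rho x0 x1 t.
  by rewrite ger0_norm// ler_piMr// (le_trans (C0_le_normR f t)).
have hA : 2^-1 <= A.
  have h1 : normR (phi (K x1)) <= c by apply: phic => t; exact: kb.
  have h2 : normR (phi x1) <= A + normR (phi (K x1)).
    by rewrite /A -[X in phi X](subrK (K x1)) linearD normRD.
  lra.
have hfar f : normR (phi (f - K f)) <= (A + tau) * normR f.
  have [e e1 ee] := unimodularP (phi x1).
  have [d d1 dd] := unimodularP (e * phi (f - K f)).
  rewrite normRM e1 mul1r in dd.
  (* Scaled by the norm of f, which spares normalizing f. *)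
  pose g := d *: (f - K f) + (normR f)%:C *: K x1.
  have f0 := normR_ge0 f.
  have gn : normR g <= normR f.
    apply: normR_C0_le => // t; have /andP[k0 kk1] := far_itv rho x0 x1 t.
    have -> : g t = d * ((1 - k t)%:C * f t) + (normR f)%:C * ((k t)%:C * x1 t).
      rewrite [LHS](_ : _ = d * (f t - K f t) + (normR f)%:C * K x1 t)// !KE.
      by rewrite rmorphB rmorph1; ring.
    apply: le_trans (normRD _ _) _; rewrite !normRM !normRr d1 mul1r.
    rewrite !ger0_norm ?subr_ge0//.
    have h0 : (1 - k t) * normR (f t) <= (1 - k t) * normR f.
      by rewrite ler_wpM2l ?subr_ge0// C0_le_normR.
    have h1 : normR f * (k t * normR (x1 t)) <= normR f * k t.
      by rewrite ler_wpM2l// ler_piMr// (le_trans (C0_le_normR x1 t)).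
    lra.
  have N0 : 0 <= N.
    have c0 : 0 <= c.
      apply: le_trans (phic 0 _); first exact: normR_ge0.
      move=> t; rewrite (_ : (0 : C0 R L) t = 0)//.
      by have /andP[] := far_itv rho x0 x1 t; rewrite normR0.
    lra.
  have h1 : normR (phi g) <= N * normR f.
    by apply: le_trans (phiN g) _; rewrite ler_wpM2l.
  have h2 : e * phi g = (normR (phi (f - K f)) + normR f * normR (phi x1))%:C
     - (normR f)%:C * e * phi (x1 - K x1).
    have -> : phi g = d * phi (f - K f) + (normR f)%:C * phi (K x1).
      by rewrite /g linearD !linearZ.
    by rewrite (linearB phi x1) rmorphD rmorphM/= -dd -ee; ring.
  have h3 : normR (phi (f - K f)) + normR f * normR (phi x1) <=
            normR (phi g) + normR f * A.
    have -> : normR (phi g) = normR (e * phi g) by rewrite normRM e1 mul1r.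
    have -> : normR f * A = normR ((normR f)%:C * e * phi (x1 - K x1)).
      by rewrite !normRM e1 normRr ger0_norm// mulr1.
    apply: le_trans _ (normRD _ _); rewrite h2 subrK normRr ler_norm//.
  have : (N - tau) * normR f <= normR (phi x1) * normR f by rewrite ler_wpM2r.
  lra.
have [e e1 ee] := unimodularP (phi (x1 - K x1)).
pose Lam f := ((A + tau)^-1)%:C * e * phi (f - K f).
pose P0 f := f - K f + Lam f *: K x1.
have P0lin : linear P0.
  move=> b f g; rewrite /P0 /Lam (linearP K).
  have -> : b *: f + g - (b *: K f + K g) = b *: (f - K f) + (g - K g).
    by rewrite scalerBr opprD addrACA.
  have -> : phi (b *: (f - K f) + (g - K g)) = b * phi (f - K f) + phi (g - K g).
    by rewrite linearD linearZ.
  rewrite [in LHS]mulrDr mulrCA scalerDl.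
  by rewrite [in RHS]scalerDr scalerA addrACA.
pose PM := GRing.isLinear.Build R[i] (C0 R L) (C0 R L) *:%R P0 P0lin.
pose P : {linear C0 R L -> C0 R L} := HB.pack P0 PM.
have At0 : 0 < A + tau by lra.
have Lam_le f : normR (Lam f) <= normR f.
  rewrite /Lam !normRM e1 mulr1 normRr ger0_norm ?invr_ge0 ?(ltW At0)//.
  by rewrite mulrC ler_pdivrMr// mulrC.
have LamX : Lam x = (A / (A + tau))%:C.
  by rewrite /Lam Hx -mulrA ee -rmorphM mulrC.
exists x, P; split=> //.
- move=> f; apply: normR_C0_le => [|t]; first exact: normR_ge0.
  have -> : P f t = (1 - k t)%:C * f t + Lam f * ((k t)%:C * x1 t).
    rewrite [LHS](_ : _ = (f t - K f t) + Lam f * K x1 t)// !KE.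
    by rewrite rmorphB rmorph1; ring.
  move: (Lam f) (Lam_le f) => l lf.
  have /andP[k0 kk1] := far_itv rho x0 x1 t.
  apply: le_trans (normRD _ _) _; rewrite !normRM !normRr.
  rewrite !ger0_norm ?subr_ge0//.
  have h0 : (1 - k t) * normR (f t) <= (1 - k t) * normR f.
    by rewrite ler_wpM2l ?subr_ge0// C0_le_normR.
  have h1 : normR l * (k t * normR (x1 t)) <= normR f * k t.
    apply: ler_pM; rewrite ?normR_ge0 ?mulr_ge0 ?normR_ge0//.
    by rewrite ler_piMr// (le_trans (C0_le_normR x1 t)).
  lra.
- apply: normR_C0_le => [|t]; first by rewrite mulr_ge0 ?ltW.
  have -> : (P x - x1) t = (Lam x - 1) * K x1 t.
    rewrite [LHS](_ : _ = (x - K x) t + Lam x * K x1 t - x1 t)// Hx.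
    rewrite (_ : (x1 - K x1) t = x1 t - K x1 t)//.
    by move: (Lam x) (K x1 t) => l m; ring.
  have /andP[k0 kk1] := far_itv rho x0 x1 t.
  rewrite normRM LamX -[X in _ - X](rmorph1 (real_complex R)) -rmorphB normRr.
  have -> : A / (A + tau) - 1 = - (tau / (A + tau)) by field; lra.
  rewrite normrN (@ger0_norm _ (tau / _)) ?divr_ge0 ?(ltW tau0) ?(ltW At0)//.
  apply: (@le_trans _ _ (tau / (A + tau) * 1)).
    rewrite ler_wpM2l ?divr_ge0 ?(ltW tau0) ?(ltW At0)//.
    exact: le_trans (kb x1 t n1) kk1.
  rewrite mulr1 ler_pdivrMr//; nra.
- move=> f f1 t.
  have -> : (P f - f) t = Lam f * K x1 t - K f t.
    rewrite [LHS](_ : _ = (f t - K f t) + Lam f * K x1 t - f t)//.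
    by move: (Lam f) (K x1 t) (K f t) => l m n; ring.
  apply: le_trans (normRD _ _) _; rewrite normRN normRM.
  have h1 : normR (Lam f) * normR (K x1 t) <= 1 * k t.
    by rewrite ler_pM ?normR_ge0 ?kb// (le_trans (Lam_le f)).
  have := kb f t f1; rewrite -/(k t); lra.
Qed.

End Rerouting.

(** * Concentration of a form near its maximum *)

Section Concentration.
Variables (R : realType) (L1 L2 : topologicalType).
Implicit Types (B : {bilinear (C0 R L1) -> (C0 R L2) -> R[i] | *%R & *%R}).

(** Complex uniform convexity of the dual, made quantitative. For [D = y - v^2 y'],
    with [y'] the conjugate of [y], the points [u + w] and [u - w] are in the unit
    ball, [v + s/2 D] and [v - s/2 D] are in the ball of radius [1 + s^2], and adding
    the two values of [B] leaves [2 B u v + s B w D]. The antilinear part of [D] is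
    then removed by combining [y] with [i y]. *)
Lemma form_slack_le B (u w : C0 R L1) (v y : C0 R L2) (s : R) :
    (forall x y, normR (B x y) <= normR x * normR y) ->
    0 < s <= 1 -> (forall t, normR (u t) + normR (w t) <= 1) ->
    normR v <= 1 -> normR y <= 1 -> 1 - s ^+ 2 <= complex.Re (B u v) ->
  normR (B w y) <= 4 * s.
Proof.
move=> Bc /andP[s0 s1] uw v1 y1 Buv.
have zP (z : C0 R L2) : normR z <= 1 ->
    exists2 D : C0 R L2, (forall t, D t = z t - v t * v t * conjc (z t)) &
      forall w' : C0 R L1, (forall t, normR (u t) + normR (w' t) <= 1) ->
        complex.Re (B w' D) <= 4 * s.
  move=> z1.
  have qP : (fun t => v t * v t * conjc (z t)) \in @C0_pred R L2.
    apply: (@C0_dominated R L2 v).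
      have vc := @C0_continuous R L2 v.
      apply: complexM_continuous; first exact: complexM_continuous.
      exact/conjc_continuous/(@C0_continuous R L2 z).
    move=> t; rewrite !normRM normR_conj -mulrA ler_piMr ?normR_ge0//.
    by rewrite mulr_ile1 ?normR_ge0// (le_trans (C0_le_normR _ t)).
  pose D : C0 R L2 := z - MkC0 qP.
  have DE t : D t = z t - v t * v t * conjc (z t) by [].
  clearbody D.
  exists D => // w' uw'.
  have s01 : 0 <= s <= 1 by rewrite ltW.
  have gp : normR (v + (s / 2)%:C *: D) <= 1 + s ^+ 2.
    apply: normR_C0_le => [|t]; first by rewrite addr_ge0 ?sqr_ge0.
    rewrite [X in normR X](_ : _ = v t + (s / 2)%:C * D t)// DE.
    by apply: normR_tilt_le => //; apply: le_trans (C0_le_normR _ t) _.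
  have gm : normR (v - (s / 2)%:C *: D) <= 1 + s ^+ 2.
    apply: normR_C0_le => [|t]; first by rewrite addr_ge0 ?sqr_ge0.
    rewrite [X in normR X](_ : _ =
        v t + (s / 2)%:C * (- z t - v t * v t * conjc (- z t))).
      apply: normR_tilt_le => //; first exact: le_trans (C0_le_normR _ t) _.
      by rewrite normRN; apply: le_trans (C0_le_normR _ t) _.
    rewrite [LHS](_ : _ = v t - (s / 2)%:C * D t)// DE.
    by rewrite rmorphN; ring.
  have up : normR (u + w') <= 1.
    apply: normR_C0_le => // t; exact: le_trans (normRD _ _) (uw' t).
  have um : normR (u - w') <= 1.
    apply: normR_C0_le => // t; apply: le_trans (normRD _ _) _.
    by rewrite [X in _ + X](_ : _ = normR (w' t)) ?uw'// normRN.
  have B1 (f : C0 R L1) (g : C0 R L2) : normR f <= 1 -> normR g <= 1 + s ^+ 2 ->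
      complex.Re (B f g) <= 1 + s ^+ 2.
    move=> f1 g1; apply: le_trans (Re_le_normR _) _; apply: le_trans (Bc _ _) _.
    by rewrite -[leRHS]mul1r ler_pM ?normR_ge0.
  have := lerD (B1 _ _ up gp) (B1 _ _ um gm).
  rewrite -[leLHS]raddfD/=.
  have -> : B (u + w') (v + (s / 2)%:C *: D) +
      B (u - w') (v - (s / 2)%:C *: D) = 2%:R%:C * B u v + s%:C * B w' D.
    have -> : s%:C = 2%:R%:C * (s / 2)%:C :> R[i].
      by rewrite -rmorphM; congr _%:C; field.
    rewrite linearDl linearBl !(linearBr, linearDr, linearZr)/=.
    rewrite rmorph_nat; ring.
  rewrite raddfD/= !Re_realM => h.
  have : s * complex.Re (B w' D) <= s * (4 * s) by lra.
  by rewrite ler_pM2l.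
have [c c1 cB] := unimodularP (B w y).
have [D DE DB] := zP _ y1.
have i1 : normR ('i : R[i]) = 1.
  by rewrite /normR normc_def/= expr0n/= add0r expr1n sqrtr1.
have iy1 : normR ('i *: y) <= 1 by rewrite normR_scale i1 mul1r.
have [D' DE' DB'] := zP _ iy1.
have uwZ (b : R[i]) : normR b = 1 ->
    forall t, normR (u t) + normR ((b *: w) t) <= 1.
  by move=> b1 t; rewrite [X in _ + X](normRM b (w t)) b1 mul1r uw.
have h1 := DB _ (uwZ _ c1).
have ic1 : normR (- 'i * c) = 1 by rewrite normRM c1 normRN i1 mul1r.
have h2 := DB' _ (uwZ _ ic1).
have h3 : D - 'i *: D' = 2 *: y.
  apply: C0_ext => t; rewrite [LHS](_ : _ = D t - 'i * D' t)// DE DE'.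
  rewrite [RHS](_ : _ = 2 * y t)// [('i *: y) t](_ : _ = 'i * y t)//.
  case: (y t) (v t) => [p q] [p' q']; simpc; congr (_ +i* _); ring.
have h4 : complex.Re (B (c *: w) D) + complex.Re (B ((- 'i * c) *: w) D') =
    2 * normR (B w y).
  rewrite -[LHS]raddfD/=.
  have -> : B (c *: w) D + B ((- 'i * c) *: w) D' = 2%:C * (c * B w y).
    have h : B w D - 'i * B w D' = 2 * B w y.
      have <- : B w (2 *: y) = 2 * B w y by rewrite linearZr.
      by rewrite -h3 linearBr linearZr.
    rewrite !linearZl/=.
    transitivity (c * (B w D - 'i * B w D')); first ring.
    by rewrite h rmorph_nat; ring.
  by rewrite cB -rmorphM.
lra.
Qed.

End Concentration.

Section FarFunctions.
Variables (R : realType) (L1 L2 : topologicalType).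
Variable B : {bilinear (C0 R L1) -> (C0 R L2) -> R[i] | *%R & *%R}.
Variables (x0 x1 : C0 R L1) (y0 y1 : C0 R L2) (rho s : R).
Hypothesis B1 : forall x y, normR (B x y) <= normR x * normR y.
Hypotheses (rho_gt0 : 0 < rho) (s_itv : 0 < s <= 1).
Hypotheses (x0_le1 : normR x0 <= 1) (x1_le1 : normR x1 <= 1).
Hypotheses (y0_le1 : normR y0 <= 1) (y1_le1 : normR y1 <= 1).
Hypotheses (B00 : 1 - s ^+ 2 <= complex.Re (B x0 y0))
  (B01 : 1 - s ^+ 2 <= complex.Re (B x0 y1))
  (B10 : 1 - s ^+ 2 <= complex.Re (B x1 y0))
  (B11 : 1 - s ^+ 2 <= complex.Re (B x1 y1)).

(** [form_slack_le] at the midpoints; a function bounded by twice the cutoff fits into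
    the slack of the midpoint of [x0] and [x1] after multiplication by [rho^2 / 16]. *)
Lemma form_far_le (z : C0 R L1) (y : C0 R L2) :
  (forall t, normR (z t) <= 2 * far rho x0 x1 t) -> normR y <= 1 ->
  normR (B z y) <= 64 * s / rho ^+ 2.
Proof.
move=> zf y_le1.
pose u : C0 R L1 := (2^-1)%:C *: (x0 + x1).
pose v : C0 R L2 := (2^-1)%:C *: (y0 + y1).
pose w : C0 R L1 := (rho ^+ 2 / 16)%:C *: z.
have r0 : 0 < rho ^+ 2 by rewrite exprn_gt0.
have Bw : normR (B w y) <= 4 * s.
  apply: (@form_slack_le _ _ _ B u w v) => //.
  - move=> t; have x0t := le_trans (C0_le_normR x0 t) x0_le1.
    have x1t := le_trans (C0_le_normR x1 t) x1_le1.
    apply: le_trans _ (normR_midpoint_le x0t x1t).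
    rewrite lerD2l [X in normR X](_ : _ = (rho ^+ 2 / 16)%:C * z t)//.
    rewrite normRM normRr ger0_norm; last by rewrite divr_ge0// ltW.
    have h1 : far rho x0 x1 t <= normR (x1 t - x0 t) ^+ 2 / rho ^+ 2.
      by rewrite /far ge_min lexx orbT.
    rewrite ler_pdivlMr// in h1.
    have h2 : rho ^+ 2 / 16 * normR (z t) <= rho ^+ 2 / 16 * (2 * far rho x0 x1 t).
      by rewrite ler_wpM2l// divr_ge0// ltW.
    lra.
  - apply: normR_C0_le => // t.
    have y0t := le_trans (C0_le_normR y0 t) y0_le1.
    have y1t := le_trans (C0_le_normR y1 t) y1_le1.
    apply: le_trans (normR_midpoint_le y0t y1t).
    by rewrite lerDl divr_ge0 ?sqr_ge0.
  - have -> : B u v = (4^-1)%:C * (B x0 y0 + B x0 y1 + B x1 y0 + B x1 y1).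
      rewrite /u /v linearZl linearZr/= linearDl !linearDr/=.
      have -> : (4^-1)%:C = (2^-1)%:C * (2^-1)%:C :> R[i].
        by rewrite -rmorphM; congr _%:C; field.
      ring.
    rewrite Re_realM !raddfD/=.
    by have := B00; have := B01; have := B10; have := B11; lra.
move: Bw; rewrite /w linearZl/= normRM normRr ger0_norm; last first.
  by rewrite divr_ge0// ltW.
by rewrite ler_pdivlMr// => h; lra.
Qed.

End FarFunctions.

(** * One improvement step *)

(** [|b| + a p q] can come close to [1 + a] only if [p q] is close to 1; comparing
    squares shows that [b] must moreover be nearly in phase with the positive number
    [a p q]. *)
Lemma perturbation_forces (R : realType) (b : R[i]) (a p q eta theta : R) :
    0 < a <= 1 -> 0 <= p <= 1 -> 0 <= q <= 1 -> normR b <= 1 -> 0 <= eta ->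
    theta < 1 -> 8 * eta <= a * theta ->
    1 + a - 4 * eta <= normR (b + (a * (p * q))%:C) ->
  [/\ 1 - theta <= p, 1 - theta <= q & 1 - theta <= complex.Re b].
Proof.
move=> /andP[a0 a1] /andP[p0 p1] /andP[q0 q1] b1 eta0 th1 eath h.
have pq0 : 0 <= p * q by rewrite mulr_ge0.
have pqp : p * q <= p by rewrite ler_piMr.
have pqq : p * q <= q by rewrite ler_piMl.
have hpq : a * (1 - theta) <= a * (p * q).
  have := normRD b (a * (p * q))%:C; rewrite normRr ger0_norm ?mulr_ge0 ?(ltW a0)//.
  lra.
rewrite ler_pM2l// in hpq.
split; [lra|lra|].
have pq1 : p * q <= 1 by lra.
set r := p * q in h pq0 pq1 hpq *.
have h2 : (1 + a - 4 * eta) ^+ 2 <= normR (b + (a * r)%:C) ^+ 2.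
  rewrite ler_sqr ?nnegrE ?normR_ge0//.
  have : a * theta <= a * 1 by rewrite ler_pM2l// ltW.
  lra.
have bsq : normR b ^+ 2 <= 1 by rewrite expr_le1 ?normR_ge0.
have h3 : normR (b + (a * r)%:C) ^+ 2 =
    normR b ^+ 2 + 2 * (a * r) * complex.Re b + (a * r) ^+ 2.
  by rewrite !normR_sqr; case: (b) => c d /=; ring.
have ar : (a * r) ^+ 2 <= a ^+ 2.
  by rewrite ler_sqr ?nnegrE ?mulr_ge0 ?(ltW a0)// ler_piMr// ltW.
have ea : eta * a <= eta by rewrite ler_piMr.
have h4 : a * (1 - theta) <= a * (r * complex.Re b).
  have := sqr_ge0 eta; lra.
rewrite ler_pM2l// in h4.
have [bp|bn] := leP 0 (complex.Re b).
  by apply: le_trans h4 _; rewrite ler_piMl.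
have : r * complex.Re b <= 0 by rewrite mulr_ge0_le0// ltW.
lra.
Qed.

(** [reroute] for the functional [S _ y1], the smallness in the far region being
    supplied by [form_far_le]: the rank-one term of [S] at most doubles the bound. *)
Lemma reroute_left (R : realType) (L1 L2 : topologicalType)
    (B : {bilinear (C0 R L1) -> (C0 R L2) -> R[i] | *%R & *%R})
    (x0 x1 : C0 R L1) (y0 y1 : C0 R L2) (rho s a N tau : R) :
    (forall x y, normR (B x y) <= normR x * normR y) ->
    0 < rho -> 0 < s <= 1 -> 0 <= a <= 1 -> 0 < tau ->
    normR x0 <= 1 -> normR x1 <= 1 -> normR y0 <= 1 -> normR y1 <= 1 ->
    1 - s ^+ 2 <= complex.Re (B x0 y0) -> 1 - s ^+ 2 <= complex.Re (B x0 y1) ->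
    1 - s ^+ 2 <= complex.Re (B x1 y0) -> 1 - s ^+ 2 <= complex.Re (B x1 y1) ->
    let S := perturbed B a x0 y0 in
    (forall x y, normR (S x y) <= N * normR x * normR y) ->
    N - tau <= normR (S x1 y1) ->
    2^-1 <= N - tau - 64 * s / rho ^+ 2 ->
  exists (x : C0 R L1) (P : {linear C0 R L1 -> C0 R L1}),
    [/\ normR x <= 1, normR (x - x0) <= rho,
        (forall f, normR (P f) <= normR f), normR (P x - x1) <= 2 * tau &
        forall f y, normR f <= 1 -> normR y <= 1 ->
          normR (S (P f) y - S f y) <= 2 * (64 * s / rho ^+ 2)].
Proof.
move=> B1 rho0 s01 a01 tau0 nx0 nx1 ny0 ny1 B00 B01 B10 B11 S SN Sxy hN.
have far2 (z : C0 R L1) (y : C0 R L2) :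
    (forall t, normR (z t) <= 2 * far rho x0 x1 t) -> normR y <= 1 ->
    normR (S z y) <= 2 * (64 * s / rho ^+ 2).
  move=> zf y1'.
  have h (y' : C0 R L2) : normR y' <= 1 -> normR (B z y') <= 64 * s / rho ^+ 2.
    exact: (@form_far_le _ _ _ B x0 x1 y0 y1).
  apply: le_trans (perturbed_le B1 ny0 nx0 a01 y1' (h _ y1') (h _ ny0)) _.
  apply: ler_wpM2r; first exact: le_trans (normR_ge0 _) (h _ y1').
  by case/andP: a01; lra.
have N0 : 0 <= N.
  have h0 : 0 <= 64 * s / rho ^+ 2.
    by case/andP: s01 => s0 _; rewrite divr_ge0 ?mulr_ge0 ?sqr_ge0// ltW.
  lra.
have [||x [P [xn xd Pn Px Pf]]] := @reroute R L1 (applyr S y1) x0 x1 rho N tau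
    (64 * s / rho ^+ 2) rho0 tau0 nx0 nx1 _ Sxy _ hN.
- move=> f; apply: le_trans (SN _ _) _.
  by rewrite ler_piMr// mulr_ge0 ?normR_ge0.
- move=> z zf.
  have : normR (S (2 *: z) y1) <= 2 * (64 * s / rho ^+ 2).
    apply: far2 => // t; rewrite [X in normR X](_ : _ = 2 * z t)// normRM.
    rewrite -[2]/(2%:R) -(rmorph_nat (real_complex R)) normRr ger0_norm//.
    by rewrite ler_pM2l.
  rewrite linearZl/= normRM -[2]/(2%:R) -(rmorph_nat (real_complex R)) normRr.
  by rewrite ger0_norm// ler_pM2l.
exists x, P; split=> // f y f1 y1'.
rewrite -linearBl; apply: far2 => // t; exact: Pf.
Qed.

(** The perturbed form has norm at least [1 + a - 3 eta], by its value at [(x0, y0)].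
    Rotating a near maximizer so that [B x1 y0] and [B x0 y1] are nonnegative does not
    change the modulus of its value, and [perturbation_forces] applies. *)
Lemma perturbed_near_max (R : realType) (X Y : completeNormedModType R[i])
    (B : {bilinear X -> Y -> R[i] | *%R & *%R}) x0 y0 (b a eta theta tau : R) :
    (forall x y, normR (B x y) <= normR x * normR y) ->
    normR x0 <= 1 -> normR y0 <= 1 -> B x0 y0 = b%:C -> 1 - eta < b ->
    0 < a <= 1 -> theta < 1 -> 8 * eta <= a * theta -> 0 < tau <= eta ->
    let S := perturbed B a x0 y0 in
  exists (N : R) x1 y1,
    [/\ 1 + a - 3 * eta <= N <= 1 + a,
        (forall x y, normR (S x y) <= N * normR x * normR y),
        normR x1 <= 1 /\ normR y1 <= 1, N - tau <= normR (S x1 y1) &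
        [/\ 1 - theta <= complex.Re (B x0 y0), 1 - theta <= complex.Re (B x0 y1),
            1 - theta <= complex.Re (B x1 y0) & 1 - theta <= complex.Re (B x1 y1)]].
Proof.
move=> B1 nx0 ny0 B00 b_gt a01 theta1 eta_a /andP[tau0 tau_eta] S.
have /andP[a0 a1] := a01.
have Bball x y : normR x <= 1 -> normR y <= 1 -> normR (B x y) <= 1.
  by move=> nx ny; apply: le_trans (B1 _ _) _; rewrite mulr_ile1 ?normR_ge0.
have b1 : b <= 1.
  by have := Bball _ _ nx0 ny0; rewrite B00 normRr; apply: le_trans (ler_norm _).
have Sball x y : normR x <= 1 -> normR y <= 1 -> normR (S x y) <= 1 + a.
  move=> nx ny; rewrite -[leRHS]mulr1.
  by apply: perturbed_le => //; [rewrite ltW|exact: Bball|exact: Bball].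
have Sb : bounded_bform S.
  apply: (@bounded_bform_le _ _ _ _ (1 + a)); first by rewrite addr_ge0// ltW.
  exact: form_le_ball Sball.
have Nle : bform_norm S <= 1 + a by exact: bform_norm_le Sball.
have Nge : 1 + a - 3 * eta <= bform_norm S.
  apply: le_trans (bform_norm_ub Sb nx0 ny0).
  rewrite [S x0 y0](_ : _ = (b + a * (b * b))%:C); last first.
    rewrite [LHS]/= B00 rmorphD [X in _ = _ + X]rmorphM.
    by rewrite [X in _ = _ + _ * X]rmorphM.
  rewrite normRr; apply: le_trans (ler_norm _).
  have eta1 : 0 <= 1 - eta.
    have : a * theta <= 1 by rewrite mulr_ile1 ?(ltW a0) ?(ltW theta1)//; nra.
    lra.
  have hbb : (1 - eta) * (1 - eta) <= b * b by rewrite ler_pM// ltW.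
  have h1 : a * (1 - 2 * eta) <= a * (b * b).
    by rewrite ler_pM2l//; have := sqr_ge0 eta; lra.
  have h2 : a * eta <= eta by rewrite ler_piMl//; lra.
  lra.
have [x1' [y1' [nx1' ny1' hmax]]] := bform_near_max Sb tau0.
have [c1 c11 c1E] := unimodularP (B x1' y0).
have [c2 c21 c2E] := unimodularP (B x0 y1').
have rotate (V : normedModType R[i]) (c : R[i]) (v : V) :
    normR c = 1 -> normR v <= 1 -> normR (c *: v) <= 1.
  by move=> c_1 nv; rewrite normR_scale c_1 mul1r.
have nx1 := rotate _ _ _ c11 nx1'; have ny1 := rotate _ _ _ c21 ny1'.
have S11 : normR (S (c1 *: x1') (c2 *: y1')) = normR (S x1' y1').
  by rewrite linearZl linearZr/= !normRM c11 c21 !mul1r.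
have B10 : B (c1 *: x1') y0 = (normR (B x1' y0))%:C by rewrite linearZl/= c1E.
have B01 : B x0 (c2 *: y1') = (normR (B x0 y1'))%:C by rewrite linearZr/= c2E.
exists (bform_norm S), (c1 *: x1'), (c2 *: y1').
have Smax : bform_norm S - tau <= normR (S (c1 *: x1') (c2 *: y1')).
  by rewrite S11 ltW.
split; [by rewrite Nge Nle|exact: le_bform_norm|by []|by []|].
have := @perturbation_forces _ (B (c1 *: x1') (c2 *: y1')) a
  (normR (B x1' y0)) (normR (B x0 y1')) eta theta a01.
rewrite !normR_ge0 !Bball// => /(_ isT isT isT) H.
have [||hp hq hB] := H _ theta1 eta_a.
- lra.
- have -> : (a * (normR (B x1' y0) * normR (B x0 y1')))%:C =
      a%:C * (B (c1 *: x1') y0 * B x0 (c2 *: y1')) :> R[i].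
    by rewrite B10 B01 [LHS]rmorphM [X in _ * X]rmorphM.
  by rewrite -[X in normR X]/(S (c1 *: x1') (c2 *: y1')); lra.
split; rewrite ?B00 ?B01 ?B10//=.
have : a * theta <= theta by rewrite ler_piMl//; nra.
lra.
Qed.

(** Bilinearity turns the errors [P x - x1] and [Q y - y1] into a loss of order
    [tau]. *)
Lemma rerouted_form_near_max (R : realType) (X Y : normedModType R[i])
    (S : {bilinear X -> Y -> R[i] | *%R & *%R})
    (P : {linear X -> X}) (Q : {linear Y -> Y}) (N tau : R) x x1 y y1 :
    0 <= N -> 0 <= tau ->
    (forall x y, normR (S x y) <= N * normR x * normR y) ->
    (forall y, normR (Q y) <= normR y) -> normR y <= 1 -> normR x1 <= 1 ->
    normR (P x - x1) <= 2 * tau -> normR (Q y - y1) <= 2 * tau ->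
    N - tau <= normR (S x1 y1) ->
  N - tau - 4 * (N * tau) <= normR (S (P x) (Q y)).
Proof.
move=> N0 tau0 SN Qn ny nx1 Px Qy S11.
have -> : S (P x) (Q y) = S x1 y1 + (S (P x - x1) (Q y) + S x1 (Q y - y1)).
  by rewrite linearBl linearBr; ring.
set d := S (P x - x1) (Q y) + _.
have hd : normR d <= 4 * (N * tau).
  have h1 : normR (S (P x - x1) (Q y)) <= N * (2 * tau).
    apply: le_trans (SN _ _) _; rewrite -mulrA ler_wpM2l//.
    by rewrite -[leRHS]mulr1 ler_pM ?normR_ge0// (le_trans (Qn _)).
  have h2 : normR (S x1 (Q y - y1)) <= N * (2 * tau).
    apply: le_trans (SN _ _) _; rewrite -mulrA ler_wpM2l//.
    by rewrite -[leRHS]mul1r ler_pM ?normR_ge0.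
  by apply: le_trans (normRD _ _) _; lra.
have h1 : normR (S x1 y1) <= normR (S x1 y1 + d) + normR d.
  by have := normRD (S x1 y1 + d) (- d); rewrite addrK normRN.
lra.
Qed.

Lemma rerouted_form_close (R : realType) (X Y : normedModType R[i])
    (B S : {bilinear X -> Y -> R[i] | *%R & *%R})
    (P : {linear X -> X}) (Q : {linear Y -> Y}) (N a k : R) :
    1 <= N <= 1 + a ->
    (forall x y, normR (S x y) <= N * normR x * normR y) ->
    (forall x y, normR x <= 1 -> normR y <= 1 -> normR (S x y - B x y) <= a) ->
    (forall x, normR (P x) <= normR x) -> (forall y, normR (Q y) <= normR y) ->
    (forall x y, normR x <= 1 -> normR y <= 1 -> normR (S (P x) y - S x y) <= k) ->
    (forall x y, normR x <= 1 -> normR y <= 1 -> normR (S x (Q y) - S x y) <= k) ->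
  forall x y, normR (scale_form (comp_form S P Q) (N^-1)%:C x y - B x y)
    <= (2 * a + 2 * k) * normR x * normR y.
Proof.
move=> /andP[N1 Na] SN SB Pn Qn SP SQ.
have N0 : 0 < N by apply: lt_le_trans N1.
apply: (form_le_ball (B := sub_form (scale_form (comp_form S P Q) (N^-1)%:C) B)).
move=> x y nx ny.
have -> : sub_form (scale_form (comp_form S P Q) (N^-1)%:C) B x y =
    ((N^-1 - 1)%:C * S (P x) (Q y) + (S (P x) (Q y) - S x (Q y))) +
    ((S x (Q y) - S x y) + (S x y - B x y)).
  rewrite [LHS](_ : _ = (N^-1)%:C * S (P x) (Q y) - B x y)// rmorphB rmorph1; ring.
have nQy : normR (Q y) <= 1 by exact: le_trans (Qn _) _.
have nPx : normR (P x) <= 1 by exact: le_trans (Pn _) _.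
have h1 : normR ((N^-1 - 1)%:C * S (P x) (Q y)) <= a.
  rewrite normRM normRr -normrN opprB ger0_norm ?subr_ge0 ?invf_le1//.
  apply: (@le_trans _ _ ((1 - N^-1) * N)).
    rewrite ler_wpM2l ?subr_ge0 ?invf_le1//.
    apply: le_trans (SN _ _) _.
    by rewrite -mulrA ler_piMr ?(ltW N0)// mulr_ile1 ?normR_ge0.
  by rewrite mulrBl mulVf ?gt_eqF// mul1r; lra.
apply: le_trans (normRD _ _) _; apply: le_trans (lerD (normRD _ _) (normRD _ _)) _.
have := SP _ _ nx nQy; have := SQ _ _ nx ny; have := SB _ _ nx ny; lra.
Qed.

(** The parameters of one step: the perturbation has weight [a = eps / 4]; the gap [s]
    is such that [64 s / eps^2], the bound of [form_far_le] at radius [eps], equals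
    [eps / 8]; and [8 eta = a s^2] is what [perturbed_near_max] needs with
    [theta = s^2]. *)
Definition concentration_gap (R : realType) (eps : R) := eps ^+ 3 / 512.

Definition BPB_eta (R : realType) (eps : R) :=
  eps * concentration_gap eps ^+ 2 / 32.

Lemma BPB_eta_gt0 (R : realType) (eps : R) : 0 < eps -> 0 < BPB_eta eps.
Proof.
by move=> e0; rewrite divr_gt0// mulr_gt0// exprn_gt0// divr_gt0// exprn_gt0.
Qed.

Section Step.
Variables (R : realType) (L1 L2 : topologicalType).
Local Notation X := (C0 R L1).
Local Notation Y := (C0 R L2).

Definition step_close (eps : R) (B S : {bilinear X -> Y -> R[i] | *%R & *%R})
    (x0 x1 : X) (y0 y1 : Y) :=
  [/\ normR (x1 - x0) <= eps, normR (y1 - y0) <= eps &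
      forall x y, normR (S x y - B x y) <= eps * normR x * normR y].

(** The new form is [S (P x) (Q y) / N], where [S] is the perturbed form and [N] its
    norm. The perturbation and the normalization cost [a] each and the two reroutings
    [eps / 4] each, which adds up to [eps]. *)
Lemma BPB_step_real (eps : R) (B : {bilinear X -> Y -> R[i] | *%R & *%R})
    x0 y0 (b eta1 : R) :
    0 < eps < 1 ->
    (forall x y, normR (B x y) <= normR x * normR y) ->
    normR x0 <= 1 -> normR y0 <= 1 ->
    B x0 y0 = b%:C -> 1 - BPB_eta eps < b -> 0 < eta1 ->
  exists (S : {bilinear X -> Y -> R[i] | *%R & *%R}) x1 y1,
    [/\ (forall x y, normR (S x y) <= normR x * normR y),
        normR x1 <= 1, normR y1 <= 1, 1 - eta1 < normR (S x1 y1) &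
        step_close eps B S x0 x1 y0 y1].
Proof.
move=> /andP[eps0 eps1] B1 nx0 ny0 B00 b_gt eta10.
have [s [s0 s1 gapE etaE]] : exists s : R, [/\ 0 < s, s <= 512^-1,
    64 * s / eps ^+ 2 = eps / 8 & 8 * BPB_eta eps = eps / 4 * s ^+ 2].
  exists (concentration_gap eps); rewrite /concentration_gap; split.
  - by rewrite divr_gt0 ?exprn_gt0.
  - by have : eps ^+ 3 <= 1 by [rewrite exprn_ile1 ?ltW]; lra.
  - by field; rewrite gt_eqF.
  - by rewrite /BPB_eta /concentration_gap; field.
have [a [a0 a1 aE]] : exists a : R, [/\ 0 < a, a <= 4^-1 & a = eps / 4].
  by exists (eps / 4); split=> //; lra.
rewrite -aE in etaE; set eta := BPB_eta eps in etaE b_gt.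
have eta0 : 0 < eta by exact: BPB_eta_gt0.
clearbody eta.
have s2 : s ^+ 2 <= 1 / 2.
  have : s ^+ 2 <= 512^-1 ^+ 2 by rewrite ler_sqr ?nnegrE ?(ltW s0)//; lra.
  lra.
have eta_le : 8 * eta <= a / 2.
  by rewrite etaE; have : a * s ^+ 2 <= a * (1 / 2) by [rewrite ler_pM2l]; lra.
have a01 : 0 < a <= 1 by rewrite a0/=; lra.
have s01 : 0 < s <= 1 by rewrite s0/=; lra.
have a01' : 0 <= a <= 1 by rewrite ltW//=; lra.
have s2lt1 : s ^+ 2 < 1 by lra.
have [tau [tau0 tau_eta tau_eta1]] :
    exists tau : R, [/\ 0 < tau, tau <= eta & tau <= eta1 / 10].
  exists (Num.min eta (eta1 / 10)).
  by rewrite lt_min eta0 divr_gt0// !ge_min !lexx orbT.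
have tau01 : 0 < tau <= eta by rewrite tau0.
have le_eta : 8 * eta <= a * s ^+ 2 by rewrite etaE.
have [N [x1 [y1 [/andP[Nge Nle] SN [nx1 ny1] Smax
    [hB00 hB01 hB10 hB11]]]]] :=
  perturbed_near_max B1 nx0 ny0 B00 b_gt a01 s2lt1 le_eta tau01.
have N1 : 1 <= N by lra.
have hN : 2^-1 <= N - tau - 64 * s / eps ^+ 2 by rewrite gapE; lra.
have [x [P [nx dx Pn Px SP]]] := reroute_left B1 eps0 s01 a01' tau0 nx0 nx1 ny0 ny1
  hB00 hB01 hB10 hB11 SN Smax hN.
have flipE (x' : X) (y' : Y) :
    perturbed (flip B) a y0 x0 y' x' = perturbed B a x0 y0 x' y'.
  by congr (_ + _ * _); rewrite mulrC.
have flipB1 (y' : Y) (x' : X) : normR (flip B y' x') <= normR y' * normR x'.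
  by rewrite mulrC; exact: B1.
have flipN (y' : Y) (x' : X) :
    normR (perturbed (flip B) a y0 x0 y' x') <= N * normR y' * normR x'.
  by rewrite flipE mulrAC; exact: SN.
have flipmax : N - tau <= normR (perturbed (flip B) a y0 x0 y1 x1).
  by rewrite flipE.
have [y [Q [ny dy Qn Qy SQ]]] := reroute_left flipB1 eps0 s01 a01' tau0 ny0 ny1 nx0 nx1
  hB00 hB10 hB01 hB11 flipN flipmax hN.
have SQ' (x' : X) (y' : Y) : normR x' <= 1 -> normR y' <= 1 ->
    normR (perturbed B a x0 y0 x' (Q y') - perturbed B a x0 y0 x' y')
      <= 2 * (64 * s / eps ^+ 2).
  by move=> nx' ny'; rewrite -!flipE; exact: SQ.
have SB (x' : X) (y' : Y) : normR x' <= 1 -> normR y' <= 1 ->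
    normR (perturbed B a x0 y0 x' y' - B x' y') <= a.
  move=> nx' ny'.
  rewrite [X in normR X](_ : _ = a%:C * (B x' y0 * B x0 y')); last first.
    by rewrite /= addrC addKr.
  rewrite normRM normRr ger0_norm ?(ltW a0)// ler_piMr ?(ltW a0)// normRM.
  have Bball (u : X) (v : Y) : normR u <= 1 -> normR v <= 1 -> normR (B u v) <= 1.
    by move=> nu nv; apply: le_trans (B1 _ _) _; rewrite mulr_ile1 ?normR_ge0.
  by rewrite mulr_ile1 ?normR_ge0 ?Bball.
have N1a : 1 <= N <= 1 + a by rewrite N1.
have N0 : 0 < N by exact: lt_le_trans N1.
have Smax' := rerouted_form_near_max (ltW N0) (ltW tau0) SN Qn ny nx1 Px Qy Smax.
have Sclose := rerouted_form_close N1a SN SB Pn Qn SP SQ'.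
move: (perturbed B a x0 y0) SN Smax' Sclose => S SN Smax' Sclose.
have normS (x' : X) (y' : Y) : normR (scale_form (comp_form S P Q) (N^-1)%:C x' y') =
    normR (S (P x') (Q y')) / N.
  by rewrite normRM normRr ger0_norm ?invr_ge0 ?(ltW N0)// mulrC.
exists (scale_form (comp_form S P Q) (N^-1)%:C), x, y.
split; [|exact: nx|exact: ny| |split; [exact: dx|exact: dy|]].
- move=> x' y'; rewrite normS ler_pdivrMr// mulrC.
  apply: le_trans (SN _ _) _; rewrite -mulrA ler_wpM2l ?(ltW N0)//.
  by rewrite ler_pM ?normR_ge0.
- rewrite normS ltr_pdivlMr//; apply: lt_le_trans Smax'.
  have h1 : tau <= N * tau by rewrite ler_peMl// ltW.
  have h2 : N * tau <= N * (eta1 / 10) by rewrite ler_pM2l.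
  have h3 : 0 < N * eta1 by rewrite mulr_gt0.
  lra.
- move=> x' y'; rewrite (_ : eps = 2 * a + 2 * (2 * (64 * s / eps ^+ 2))).
    exact: Sclose.
  by rewrite gapE aE; field.
Qed.

End Step.

(** * Passage to the limit *)

Section Geometric.
Variable R : realType.

Lemma exp2_gt_nat n : (n%:R : R) < 2 ^+ n.
Proof. by rewrite -natrX ltr_nat ltn_expl. Qed.

Lemma geometric_small (e d : R) : 0 < d -> exists n, e / 2 ^+ n < d.
Proof.
move=> d0; have [n hn] : exists n, e / d < n%:R :> R.
  exists (Num.truncn (e / d)).+1.
  by have := truncnS_gt (e / d).
exists n; rewrite ltr_pdivrMr ?exprn_gt0// mulrC -ltr_pdivrMr//.
exact: lt_trans hn (exp2_gt_nat n).
Qed.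

Lemma geometric_half (e : R) n : 0 <= e -> e / 2 ^+ n.+1 <= e / 2 ^+ n.
Proof.
move=> e0; rewrite exprS invfM ler_wpM2l// ler_piMl ?invr_ge0 ?exprn_ge0//.
by rewrite invf_le1// ler1n.
Qed.

Lemma le_geometric (a b e : R) : (forall n, a <= b + e / 2 ^+ n) -> a <= b.
Proof.
move=> h; apply/ler_addgt0Pr => d d0.
have [n hn] := geometric_small e d0.
by apply: le_trans (h n) _; rewrite lerD2l ltW.
Qed.

Lemma geometric_cvg (V : completeNormedModType R[i]) (u : nat -> V) (e : R) :
  (forall n, normR (u n.+1 - u n) <= e / 2 ^+ n.+2) ->
  exists2 l, u n @[n --> \oo] --> l & forall n, normR (l - u n) <= e / 2 ^+ n.+1.
Proof.
move=> ue.
have e0 : 0 <= e.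
  have := le_trans (normR_ge0 _) (ue 0%N).
  by rewrite pmulr_lge0// invr_gt0 exprn_gt0.
have um n k : normR (u (k + n)%N - u n) <= e / 2 ^+ n.+1 - e / 2 ^+ (k + n).+1.
  elim: k => [|k IH]; first by rewrite add0n !subrr normR0.
  rewrite addSn -[X in normR X](subrKA (u (k + n)%N)).
  apply: le_trans (normRD _ _) _; apply: le_trans (lerD (ue _) IH) _.
  rewrite [2 ^+ (k + n).+2]exprS invfM; lra.
have umn n m : (n <= m)%N -> normR (u m - u n) <= e / 2 ^+ n.+1.
  move=> nm; rewrite -(subnK nm); apply: le_trans (um _ _) _.
  by rewrite gerBl divr_ge0 ?exprn_ge0.
have uc : cauchy (u n @[n --> \oo]).
  apply: cauchy_exP => _ /gt0_complexE[d d0 ->].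
  have [n hn] := geometric_small e d0.
  exists (u n); exists n => // m /= nm.
  rewrite -ball_normE/= normR_lt normRB; apply: le_lt_trans (umn _ _ nm) _.
  exact: le_lt_trans (geometric_half n e0) hn.
have /cvg_ex[l ul] : cvg (u n @[n --> \oo]) by exact: cauchy_cvg.
exists l => // n; apply/ler_addgt0Pr => d d0.
have dC0 : 0 < d%:C by rewrite ltcR.
have /cvgrPdist_lt/(_ _ dC0)[N _ hN] := ul.
have := hN (maxn N n) (leq_maxl _ _); rewrite normR_lt => h.
rewrite -[X in normR X](subrKA (u (maxn N n))).
apply: le_trans (normRD _ _) _.
by rewrite [leRHS]addrC lerD ?umn ?leq_maxr// ltW.
Qed.

End Geometric.

Section Limit.
Variables (R : realType) (L1 L2 : topologicalType).
Local Notation X := (C0 R L1).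
Local Notation Y := (C0 R L2).

(** The form is rotated so that its value becomes a positive number, and rotated back
    after the step; rotating the form rather than the points keeps the points fixed. *)
Lemma BPB_step (eps : R) (B : {bilinear X -> Y -> R[i] | *%R & *%R})
    x0 y0 (eta1 : R) :
    0 < eps < 1 ->
    (forall x y, normR (B x y) <= normR x * normR y) ->
    normR x0 <= 1 -> normR y0 <= 1 ->
    1 - BPB_eta eps < normR (B x0 y0) -> 0 < eta1 ->
  exists (S : {bilinear X -> Y -> R[i] | *%R & *%R}) x1 y1,
    [/\ (forall x y, normR (S x y) <= normR x * normR y),
        normR x1 <= 1, normR y1 <= 1, 1 - eta1 < normR (S x1 y1) &
        step_close eps B S x0 x1 y0 y1].
Proof.
move=> e01 B1 nx0 ny0 hB eta10.
have [c c1 cE] := unimodularP (B x0 y0).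
have c0 : c != 0.
  by apply/eqP => c0; move: c1; rewrite c0 normR0 => /esym/eqP; rewrite oner_eq0.
have cV : normR c^-1 = 1.
  by rewrite -[LHS]mul1r -[X in X * _]c1 -normRM mulfV// normR1.
have [|S [x1 [y1 [S1 nx1 ny1 hS [dx dy dS]]]]] :=
  BPB_step_real e01 (B := scale_form B c) _ nx0 ny0 cE hB eta10.
  by move=> x y; rewrite /= normRM c1 mul1r.
exists (scale_form S c^-1), x1, y1; split=> //.
- by move=> x y; rewrite /= normRM cV mul1r.
- by rewrite /= normRM cV mul1r.
split=> // x y.
rewrite [X in normR X](_ : _ = c^-1 * (S x y - c * B x y)).
  by rewrite normRM cV mul1r; exact: dS.
by rewrite /= mulrBr mulrA mulVf// mul1r.
Qed.

(** Each step reaches the precision that the next one requires, so the steps can be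
    chained; their sizes [eps / 2^(n+2)] add up to [eps / 2], whence the convergence of
    the points and the pointwise convergence of the forms. *)
Lemma BPB_limit (eps : R) (B : {bilinear X -> Y -> R[i] | *%R & *%R}) x0 y0 :
    0 < eps < 1 ->
    (forall x y, normR (B x y) <= normR x * normR y) ->
    normR x0 <= 1 -> normR y0 <= 1 ->
    1 - BPB_eta (eps / 4) < normR (B x0 y0) ->
  exists (S : {bilinear X -> Y -> R[i] | *%R & *%R}) x1 y1,
    [/\ (forall x y, normR (S x y) <= normR x * normR y),
        normR x1 <= 1, normR y1 <= 1, normR (S x1 y1) = 1 &
        step_close (eps / 2) B S x0 x1 y0 y1].
Proof.
move=> /andP[e0 e1] B1 nx0 ny0 hB.
pose en n : R := eps / 2 ^+ n.+2.
have en01 n : 0 < en n < 1.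
  rewrite divr_gt0 ?exprn_gt0//= ltr_pdivrMr ?exprn_gt0// mul1r.
  by apply: lt_le_trans e1 _; rewrite exprn_ege1// ler1n.
pose state := ({bilinear X -> Y -> R[i] | *%R & *%R} * X * Y)%type.
pose good n (st : state) := let: (B, x, y) := st in
  [/\ (forall x y, normR (B x y) <= normR x * normR y), normR x <= 1, normR y <= 1 &
   1 - BPB_eta (en n) < normR (B x y)].
pose close n (st st' : state) :=
  step_close (en n) st.1.1 st'.1.1 st.1.2 st'.1.2 st.2 st'.2.
have next n (st : {st | good n st}) :
    exists st' : {st | good n.+1 st}, close n (sval st) (sval st').
  case: st => [[[B' x] y] [B'1 nx ny h]] /=.
  have h0 : 0 < BPB_eta (en n.+1) by apply: BPB_eta_gt0; case/andP: (en01 n.+1).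
  have [S [x1 [y1 [S1 nx1 ny1 hS im]]]] := BPB_step (en01 n) B'1 nx ny h h0.
  have gd : good n.+1 (S, x1, y1) by [].
  by exists (exist _ _ gd).
have g0 : good 0 (B, x0, y0).
  by split=> //; rewrite /en (_ : 2 ^+ 2 = 4)//; ring.
pose seq := nat_rect (fun n => {st | good n st}) (exist _ _ g0)
  (fun n st => projT1 (cid (next n st))).
pose Bn n := (sval (seq n)).1.1.
pose xn n := (sval (seq n)).1.2; pose yn n := (sval (seq n)).2.
have gn n : [/\ (forall x y, normR (Bn n x y) <= normR x * normR y),
    normR (xn n) <= 1, normR (yn n) <= 1 &
    1 - BPB_eta (en n) < normR (Bn n (xn n) (yn n))].
  by rewrite /Bn /xn /yn; case: (seq n) => [[[B' x] y] /= g].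
have cn n : step_close (en n) (Bn n) (Bn n.+1) (xn n) (xn n.+1) (yn n) (yn n.+1).
  exact: projT2 (cid (next n (seq n))).
have B0 : Bn 0 = B by []. have x00 : xn 0 = x0 by []. have y00 : yn 0 = y0 by [].
clearbody Bn xn yn.
have [x _ xl] : exists2 l, xn n @[n --> \oo] --> l &
    forall n, normR (l - xn n) <= eps / 2 ^+ n.+1.
  by apply: geometric_cvg => n; have [] := cn n.
have [y _ yl] : exists2 l, yn n @[n --> \oo] --> l &
    forall n, normR (l - yn n) <= eps / 2 ^+ n.+1.
  by apply: geometric_cvg => n; have [] := cn n.
have Sex (x' : X) (y' : Y) : exists l : R[i], (Bn n x' y' @[n --> \oo] --> l) /\
    forall n, normR (l - Bn n x' y') <= eps * normR x' * normR y' / 2 ^+ n.+1.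
  have [n|l h1 h2] :=
    @geometric_cvg R R[i] (fun n => Bn n x' y') (eps * normR x' * normR y').
    by have [_ _ h] := cn n; apply: le_trans (h x' y') _; rewrite /en; lra.
  by exists l.
pose S0 x' y' := projT1 (cid (Sex x' y')).
have S0c x' y' : Bn n x' y' @[n --> \oo] --> S0 x' y'.
  exact: (projT2 (cid (Sex x' y'))).1.
have S0d x' y' n :
    normR (S0 x' y' - Bn n x' y') <= eps * normR x' * normR y' / 2 ^+ n.+1.
  exact: (projT2 (cid (Sex x' y'))).2.
have S0a : form_axiom S0.
  split=> [b x' x'' y'|b x' y' y''].
    apply: (cvg_unique (@norm_hausdorff _ _) (S0c _ _)).
    have -> : (fun n => Bn n (b *: x' + x'') y') =
        (fun n => b * Bn n x' y' + Bn n x'' y').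
      by apply/funext => n; rewrite linearDl linearZl.
    by apply: cvgD; [apply: cvgM; [exact: cvg_cst|]|]; exact: S0c.
  apply: (cvg_unique (@norm_hausdorff _ _) (S0c _ _)).
  have -> : (fun n => Bn n x' (b *: y' + y'')) =
      (fun n => b * Bn n x' y' + Bn n x' y'').
    by apply/funext => n; rewrite linearDr linearZr.
  by apply: cvgD; [apply: cvgM; [exact: cvg_cst|]|]; exact: S0c.
pose S := form_of S0a.
have tri (V : normedModType R[i]) (u v : V) : normR u <= normR v + normR (u - v).
  by rewrite addrC -[X in normR X <= _](subrK v) normRD.
have S1 x' y' : normR (S x' y') <= normR x' * normR y'.
  apply: (@le_geometric _ _ _ (eps * normR x' * normR y')) => n.
  apply: le_trans (tri _ _ (Bn n x' y')) _; apply: lerD; first by have [] := gn n.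
  apply: le_trans (S0d x' y' n) (geometric_half n _).
  by rewrite !mulr_ge0 ?normR_ge0 ?ltW.
have nx1 : normR x <= 1.
  apply: (@le_geometric _ _ _ eps) => n.
  apply: le_trans (tri _ _ (xn n)) _; apply: lerD; first by have [] := gn n.
  by apply: le_trans (xl n) (geometric_half n _); exact: ltW.
have ny1 : normR y <= 1.
  apply: (@le_geometric _ _ _ eps) => n.
  apply: le_trans (tri _ _ (yn n)) _; apply: lerD; first by have [] := gn n.
  by apply: le_trans (yl n) (geometric_half n _); exact: ltW.
exists S, x, y; split=> //.
  apply/le_anti/andP; split.
    by apply: le_trans (S1 _ _) _; rewrite mulr_ile1 ?normR_ge0.
  apply: (@le_geometric _ _ _ (2 * eps)) => n.
  have [Bn1 nxn nyn hn] := gn n.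
  have eta_le : BPB_eta (en n) <= en n.
    have /andP[d0 d1] := en01 n.
    rewrite /BPB_eta ler_pdivrMr// ler_wpM2l ?(ltW d0)//.
    have h : (en n) ^+ 3 <= 1 by rewrite exprn_ile1 ?ltW.
    have h' : 0 <= concentration_gap (en n) by rewrite divr_ge0 ?exprn_ge0 ?ltW.
    have : concentration_gap (en n) ^+ 2 <= 1.
      by rewrite expr_le1// /concentration_gap; lra.
    lra.
  have -> : 2 * eps / 2 ^+ n = 8 * en n by rewrite /en !exprS !invfM; lra.
  have E1 : eps / 2 ^+ n.+1 = 2 * en n by rewrite /en !exprS !invfM; lra.
  have h1 : normR (S x y - Bn n x y) <= 2 * en n.
    rewrite -E1; apply: le_trans (S0d x y n) _.
    rewrite ler_pM2r ?invr_gt0 ?exprn_gt0// -mulrA ler_piMr ?(ltW e0)//.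
    by rewrite mulr_ile1 ?normR_ge0.
  have h2 : normR (Bn n (x - xn n) y) <= 2 * en n.
    rewrite -E1; apply: le_trans (Bn1 _ _) _; apply: le_trans (xl n).
    by rewrite ler_piMr ?normR_ge0.
  have h3 : normR (Bn n (xn n) (y - yn n)) <= 2 * en n.
    rewrite -E1; apply: le_trans (Bn1 _ _) _; apply: le_trans (yl n).
    by rewrite ler_piMl ?normR_ge0.
  have h4 : normR (Bn n (xn n) (yn n)) <=
      normR (S x y) + (2 * en n + (2 * en n + 2 * en n)).
    apply: le_trans (tri _ _ (S x y)) _; rewrite lerD2l.
    have -> : Bn n (xn n) (yn n) - S x y =
        - ((S x y - Bn n x y) + (Bn n (x - xn n) y + Bn n (xn n) (y - yn n))).
      by rewrite linearBl linearBr; ring.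
    rewrite normRN.
    apply: le_trans (normRD _ _) _; apply: lerD => //.
    by apply: le_trans (normRD _ _) _; apply: lerD.
  have /andP[d0 _] := en01 n; lra.
split.
- by have := xl 0%N; rewrite x00.
- by have := yl 0%N; rewrite y00.
- by move=> x' y'; have := S0d x' y' 0%N; rewrite B0 expr1; lra.
Qed.

End Limit.

Theorem theorem2 (R : realType) :
  (forall L1 L2 : topologicalType,
     locally_compact [set: L1] -> hausdorff_space L1 ->
     locally_compact [set: L2] -> hausdorff_space L2 ->
     BPBp_bilinear (C0 R L1) (C0 R L2)) /\
  (forall eps : R, 0 < eps < 1 ->
     exists2 eta : R, 0 < eta &
       forall L1 L2 : topologicalType,
         locally_compact [set: L1] -> hausdorff_space L1 ->
         locally_compact [set: L2] -> hausdorff_space L2 ->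
         BPB_bilinear_with eps eta (C0 R L1) (C0 R L2)).
Proof.
have uniform (eps : R) : 0 < eps < 1 -> exists2 eta : R, 0 < eta &
    forall L1 L2 : topologicalType, BPB_bilinear_with eps eta (C0 R L1) (C0 R L2).
  move=> eps01; have /andP[eps0 _] := eps01.
  exists (BPB_eta (eps / 4)) => [|L1 L2 B x0 y0 Bb nB nx0 ny0 B00].
    by rewrite BPB_eta_gt0// divr_gt0.
  have nx0' : normR x0 <= 1 by rewrite -normR_le1 nx0.
  have ny0' : normR y0 <= 1 by rewrite -normR_le1 ny0.
  have B1 x y : normR (B x y) <= normR x * normR y.
    by have := le_bform_norm Bb x y; rewrite nB mul1r.
  have B00' : 1 - BPB_eta (eps / 4) < normR (B x0 y0).
    by rewrite -ltcR normRE.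
  have [S [x1 [y1 [S1 nx1 ny1 S11 [dx dy dS]]]]] :=
    BPB_limit eps01 B1 nx0' ny0' B00'.
  have normE1 (V : normedModType R[i]) (v : V) : normR v = 1 -> `|v| = 1.
    by move=> v1; rewrite -normRE v1.
  have Sb : bounded_bform S.
    by apply: (@bounded_bform_le _ _ _ S 1) => // x y; rewrite mul1r.
  have half : eps / 2 < eps by lra.
  have xy1 : 1 <= normR x1 * normR y1 by rewrite -S11.
  exists x1, y1, S; split.
  - split; apply: normE1; apply/le_anti; rewrite (nx1, ny1)/=.
      by apply: le_trans xy1 _; rewrite ler_piMr ?normR_ge0.
    by apply: le_trans xy1 _; rewrite ler_piMl ?normR_ge0.
  - split=> //; apply/le_anti; rewrite -{2}S11 bform_norm_ub// andbT.
    apply: bform_norm_le => x y nx ny; apply: le_trans (S1 x y) _.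
    by rewrite mulr_ile1 ?normR_ge0.
  - exact: normE1.
  - by split; rewrite normR_lt normRB; apply: le_lt_trans half.
  - apply: le_lt_trans half; apply: bform_norm_le => x y nx ny.
    apply: le_trans (dS x y) _; rewrite -mulrA ler_piMr ?divr_ge0 ?(ltW eps0)//.
    by rewrite mulr_ile1 ?normR_ge0.
split=> [L1 L2 _ _ _ _ eps eps01|eps eps01].
  by have [eta eta0 H] := uniform _ eps01; exists eta.
by have [eta eta0 H] := uniform _ eps01; exists eta => // L1 L2 _ _ _ _.
Qed.
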